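(* Let $N\ge2$, $\mu\in[0,1]$, $\alpha_1,\alpha_2\in(0,1)$, and let $B_1$ be the open unit ball of $\mathbb{R}^N$ centered at the origin. Let $\mathcal{L}$ be the operator $$\mathcal{L}u(x)=P.V.\int_{\mathbb{R}^N}(u(x)-u(y))K_\mu(x-y)\,dy,\qquad K_\mu(x)=\begin{cases}\dfrac{1}{|x|^{N+2\alpha_1}}, & |x|<1,\\[2mm] \dfrac{\mu}{|x|^{N+2\alpha_2}}, & |x|\ge 1.\end{cases}$$ Let $f:[0,\infty)\to\mathbb{R}$ be locally Lipschitz and let $g:B_1\to\mathbb{R}$ be radially symmetric and decreasing in $|x|$. If $u$ is a positive classical solution of $$\mathcal{L}u(x)=f(u(x))+g(x),\ x\in B_1,\qquad u(x)=0,\ x\in B_1^c=\mathbb{R}^N\setminus B_1,$$ then $u$ is radially symmetric and strictly decreasing in $r=|x|$ for $r\in(0,1)$.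
   Context: $P.V.$ denotes the principal value of the integral at $y=x$. A classical solution is a continuous function $u:\mathbb{R}^N\to\mathbb{R}$ such that $\mathcal{L}u(x)$ is defined by the formula $\mathcal{L}u(x)=P.V.\int_{\mathbb{R}^N}(u(x)-u(y))K_\mu(x-y)\,dy$, where $K_\mu(x)=|x|^{-N-2\alpha_1}$ for $|x|<1$ and $K_\mu(x)=\mu|x|^{-N-2\alpha_2}$ for $|x|\ge1$, at every $x\in B_1$ and such that the equation in $B_1$ and the condition in $B_1^c$ hold pointwise. Positive means $u>0$ in $B_1$. ''Decreasing'' without the word ''strictly'' is understood in the non-strict sense. *)

(* Defs.v *)
From HB Require Import structures.
From mathcomp Require Import all_boot all_order all_algebra.
From mathcomp Require Import all_classical all_reals all_analysis.

Set Implicit Arguments.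
Unset Strict Implicit.
Unset Printing Implicit Defensive.

Import Order.TTheory GRing.Theory Num.Theory.
Import numFieldNormedType.Exports.

Local Open Scope classical_set_scope.
Local Open Scope ring_scope.

(* R^n is 'rV[R]_n with the product sigma-algebra, generated by the
   coordinates. *)
Definition rV_coord (R : realType) (n : nat) (i : 'I_n) (x : 'rV[R]_n) :
  measurableTypeR R := x ord0 i.

Section measurable_rV.
Context {R : realType} {n : nat}.

Let rV_measurable : set (set 'rV[R]_n) := g_sigma_preimage (@rV_coord R n).

Let rV_set0 : rV_measurable set0.
Proof. exact: sigma_algebra0. Qed.

Let rV_setC A : rV_measurable A -> rV_measurable (~` A).
Proof. exact: sigma_algebraC. Qed.

Let rV_bigcup (F : _^nat) :
  (forall i, rV_measurable (F i)) -> rV_measurable (\bigcup_i (F i)).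
Proof. exact: sigma_algebra_bigcup. Qed.

HB.instance Definition _ := @isMeasurable.Build default_measure_display
  'rV[R]_n rV_measurable rV_set0 rV_setC rV_bigcup.

End measurable_rV.

Lemma measurable_rV_coord (R : realType) (n : nat) (i : 'I_n) :
  measurable_fun [set: 'rV[R]_n] (rV_coord i).
Proof.
move=> _ Y mY; rewrite setTI; apply: sub_sigma_algebra => /=.
rewrite -bigcup_seq/=; exists i => /=; first by rewrite mem_index_enum.
by exists Y => //; rewrite setTI.
Qed.

Lemma measurable_fun_rVP (R : realType) (d : measure_display)
    (T : measurableType d) (n : nat) (h : T -> 'rV[R]_n) :
  (forall i, measurable_fun [set: T] (rV_coord i \o h)) ->
  measurable_fun [set: T] h.
Proof.
move=> mh _ Y mY; rewrite setTI.
have : g_sigma_preimage (@rV_coord R n) `<=` [set A | measurable (h @^-1` A)].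
  apply: smallest_sub.
    split => /=.
    - by rewrite preimage_set0; exact: measurable0.
    - by move=> A mA; rewrite setTD preimage_setC; exact: measurableC.
    - by move=> F mF; rewrite preimage_bigcup; exact: bigcupT_measurable.
  rewrite -bigcup_seq => _ [i _ [B mB <-]] /=; rewrite setTI -comp_preimage.
  by rewrite -[X in measurable X]setTI; exact: mh.
exact.
Qed.

Definition cons_rV (R : realType) (n : nat) (p : measurableTypeR R * 'rV[R]_n) :
  'rV[R]_n.+1 := \row_i oapp (p.2 ord0) p.1 (unlift ord0 i).

Definition uncons_rV (R : realType) (n : nat) (x : 'rV[R]_n.+1) :
  measurableTypeR R * 'rV[R]_n := (x ord0 ord0, \row_i x ord0 (lift ord0 i)).

Lemma cons_rV0 (R : realType) (n : nat) (p : measurableTypeR R * 'rV[R]_n) :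
  rV_coord ord0 (cons_rV p) = p.1.
Proof. by rewrite /rV_coord mxE unlift_none. Qed.

Lemma cons_rVS (R : realType) (n : nat) (p : measurableTypeR R * 'rV[R]_n)
    (i : 'I_n) : rV_coord (lift ord0 i) (cons_rV p) = rV_coord i p.2.
Proof. by rewrite /rV_coord mxE liftK. Qed.

Lemma cons_rVK (R : realType) (n : nat) : cancel (@cons_rV R n) (@uncons_rV R n).
Proof.
move=> [a x]; congr pair; first exact: (cons_rV0 (a, x)).
by apply/rowP => i; rewrite mxE; exact: (cons_rVS (a, x)).
Qed.

Lemma measurable_cons_rV (R : realType) (n : nat) :
  measurable_fun setT (@cons_rV R n).
Proof.
apply: measurable_fun_rVP => i; have [j ->|->] := unliftP ord0 i.
- rewrite (_ : _ \o _ = rV_coord j \o snd); last first.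
    by apply/funext => p /=; exact: cons_rVS.
  by apply: measurableT_comp => //; exact: measurable_rV_coord.
- rewrite (_ : _ \o _ = fst); last by apply/funext => p /=; exact: cons_rV0.
  exact: measurable_fst.
Qed.

Lemma measurable_uncons_rV (R : realType) (n : nat) :
  measurable_fun setT (@uncons_rV R n).
Proof.
apply/measurable_fun_pairP; split; first exact: (measurable_rV_coord ord0).
apply: measurable_fun_rVP => i.
rewrite (_ : _ \o _ = rV_coord (lift ord0 i)); first exact: measurable_rV_coord.
by apply/funext => x; rewrite /= /rV_coord mxE.
Qed.

Section pushforward_cons.
Context {R : realType} {n : nat}.
Variable m : {sigma_finite_measure set 'rV[R]_n -> \bar R}.

Let prod : {measure set (measurableTypeR R * 'rV[R]_n)%type -> \bar R} :=
  (lebesgue_measure \x m)%E.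

Let prod_sigma_finite : sigma_finite setT prod.
Proof.
have /sigma_finiteP[F [TF ndF Foo]] := sigma_finiteT (@lebesgue_measure R).
have /sigma_finiteP[G [TG ndG Goo]] := sigma_finiteT m.
exists (fun n => F n `*` G n).
  rewrite -setXTT TF TG predeqE => -[x y]; split.
    move=> [/= [i _ Fix] [k _ Gky]]; exists (maxn i k) => //; split.
    - by move: x Fix; exact/subsetPset/ndF/leq_maxl.
    - by move: y Gky; exact/subsetPset/ndG/leq_maxr.
  by move=> [i _ []/= ? ?]; split; exists i.
move=> k; have [? ?] := Foo k; have [? ?] := Goo k.
split; first exact: measurableX.
by rewrite /= product_measure1E// lte_mul_pinfty// ge0_fin_numE.
Qed.

Definition pushforward_cons : set 'rV[R]_n.+1 -> \bar R :=
  pushforward (lebesgue_measure \x m)%E (@cons_rV R n).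

Let pushforward_cons0 : pushforward_cons set0 = 0%E.
Proof. by rewrite /pushforward_cons /pushforward preimage_set0 measure0. Qed.

Let pushforward_cons_ge0 A : (0 <= pushforward_cons A)%E.
Proof. exact: (measure_ge0 prod). Qed.

Let pushforward_cons_sigma_additive : semi_sigma_additive pushforward_cons.
Proof.
move=> F mF tF mUF; rewrite /pushforward_cons /pushforward preimage_bigcup.
have mcons A : measurable A -> measurable (@cons_rV R n @^-1` A).
  by move=> mA; rewrite -[X in measurable X]setTI; exact: measurable_cons_rV.
apply: (@measure_semi_sigma_additive _ _ _ prod).
- by move=> i; exact: mcons.
- apply/trivIsetP => /= i j _ _ ij; rewrite -preimage_setI.
  by move/trivIsetP : tF => /(_ _ _ _ _ ij) ->//; rewrite preimage_set0.
- by rewrite -preimage_bigcup; exact: mcons.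
Qed.

HB.instance Definition _ := isMeasure.Build _ _ _ pushforward_cons
  pushforward_cons0 pushforward_cons_ge0 pushforward_cons_sigma_additive.

Let pushforward_cons_sigma_finite : sigma_finite setT pushforward_cons.
Proof.
have [F FT Foo] := prod_sigma_finite.
exists (fun i => @uncons_rV R n @^-1` F i).
  by rewrite -preimage_bigcup -FT preimage_setT.
move=> i; have [mF Fi] := Foo i; split.
  by rewrite -[X in measurable X]setTI; exact: measurable_uncons_rV.
rewrite /pushforward_cons /pushforward -comp_preimage.
rewrite (_ : _ \o _ = id); last by apply/funext => p /=; exact: cons_rVK.
by rewrite preimage_id.
Qed.

HB.instance Definition _ := Measure_isSigmaFinite.Build _ _ _ pushforward_cons
  pushforward_cons_sigma_finite.

End pushforward_cons.

(* Lebesgue measure on R^n, as an iterated product of the one-dimensional one;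
   see lebesgue_rV_box. *)
Fixpoint lebesgue_rV (R : realType) (n : nat) : set 'rV[R]_n -> \bar R :=
  match n with
  | 0 => \d_(0 : 'rV[R]_0)
  | m.+1 => pushforward (lebesgue_measure \x @lebesgue_rV R m)%E (@cons_rV R m)
  end.

Lemma lebesgue_rV_sigma_finite (R : realType) (n : nat) :
  exists m : {sigma_finite_measure set 'rV[R]_n -> \bar R},
    @lebesgue_rV R n = m :> (set 'rV[R]_n -> \bar R).
Proof.
elim: n => [|n [m IH]]; first by exists (\d_(0 : 'rV[R]_0)).
by exists (pushforward_cons m); rewrite /= IH.
Qed.

Section lebesgue_rV_measure.
Context {R : realType} {n : nat}.

Let lebesgue_rV0 : @lebesgue_rV R n set0 = 0%E.
Proof. by have [m ->] := lebesgue_rV_sigma_finite R n; exact: measure0. Qed.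

Let lebesgue_rV_ge0 A : (0 <= @lebesgue_rV R n A)%E.
Proof. by have [m ->] := lebesgue_rV_sigma_finite R n; exact: measure_ge0. Qed.

Let lebesgue_rV_sigma_additive : semi_sigma_additive (@lebesgue_rV R n).
Proof.
have [m ->] := lebesgue_rV_sigma_finite R n.
exact: measure_semi_sigma_additive.
Qed.

HB.instance Definition _ := isMeasure.Build _ _ _ (@lebesgue_rV R n)
  lebesgue_rV0 lebesgue_rV_ge0 lebesgue_rV_sigma_additive.

Let lebesgue_rV_sfT : sigma_finite setT (@lebesgue_rV R n).
Proof. by have [m ->] := lebesgue_rV_sigma_finite R n; exact: sigma_finiteT. Qed.

HB.instance Definition _ := Measure_isSigmaFinite.Build _ _ _ (@lebesgue_rV R n)
  lebesgue_rV_sfT.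

End lebesgue_rV_measure.

Lemma lebesgue_rV_box (R : realType) (n : nat)
    (A : 'I_n -> set (measurableTypeR R)) :
  (forall i, measurable (A i)) ->
  lebesgue_rV [set x : 'rV[R]_n | forall i, A i (rV_coord i x)] =
    (\prod_(i < n) lebesgue_measure (A i))%E.
Proof.
elim: n A => [A _|n IH A mA].
  rewrite big_ord0 /= (_ : mkset _ = setT) ?diracT//.
  by apply/seteqP; split => // x _ [].
pose B := [set x : 'rV[R]_n | forall i, A (lift ord0 i) (rV_coord i x)].
have mB : measurable B.
  rewrite (_ : B = \big[setI/setT]_(i < n) (rV_coord i @^-1` A (lift ord0 i))).
    apply: bigsetI_measurable => i _; rewrite -[X in measurable X]setTI.
    exact: measurable_rV_coord.
  by rewrite -bigcap_seq; apply/seteqP; split => x Bx i; have := Bx i;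
    rewrite /= mem_index_enum //; exact.
rewrite big_ord_recl -IH //= -/B -product_measure1E // /pushforward.
congr product_measure1; apply/seteqP; split => -[a x] /= Ax.
  split; first by have := Ax ord0; rewrite cons_rV0.
  by move=> i; have := Ax (lift ord0 i); rewrite cons_rVS.
by move=> i; have [j ->|->] := unliftP ord0 i; rewrite ?cons_rVS ?cons_rV0;
  have [] := Ax.
Qed.

(* The norm `|x| of the library on 'rV[R]_n is the sup norm. *)
Definition enorm (R : realType) (n : nat) (x : 'rV[R]_n) : R :=
  Num.sqrt (\sum_i x ord0 i ^+ 2).

Definition unit_ball (R : realType) (n : nat) : set 'rV[R]_n :=
  [set x | enorm x < 1].

Definition kernel_mu (R : realType) (n : nat) (mu a1 a2 : R) (x : 'rV[R]_n) : R :=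
  if enorm x < 1 then 1 / enorm x `^ (n%:R + 2 * a1)
  else mu / enorm x `^ (n%:R + 2 * a2).

Section principal_value_operator.
Context {R : realType} {n : nat}.
Variables (mu a1 a2 : R) (u : 'rV[R]_n -> R) (x : 'rV[R]_n).

Definition op_integrand (y : 'rV[R]_n) : R :=
  (u x - u y) * kernel_mu mu a1 a2 (x - y).

Definition outside_ball (eps : R) : set 'rV[R]_n :=
  [set y | eps < enorm (x - y)].

Definition truncated_op (eps : R) : R :=
  \int[@lebesgue_rV R n]_(y in outside_ball eps) op_integrand y.

(* Rintegral and lim are total functions, so the existence of the truncated
   integrals and of their limit has to be required separately. *)
Definition op_defined : Prop :=
  (forall eps, 0 < eps ->
     (@lebesgue_rV R n).-integrable (outside_ball eps) (EFin \o op_integrand)) /\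
  cvg (truncated_op eps @[eps --> 0^'+]).

Definition op : R := lim (truncated_op eps @[eps --> 0^'+]).

End principal_value_operator.

(* f and g are total; only their values on [0, +oo[ and on the unit ball
   matter for a nonnegative u. *)
Definition classical_solution (R : realType) (n : nat) (mu a1 a2 : R)
    (f : R -> R) (g u : 'rV[R]_n -> R) : Prop :=
  [/\ continuous u,
      forall x, unit_ball x ->
        op_defined mu a1 a2 u x /\ op mu a1 a2 u x = f (u x) + g x &
      forall x, ~ unit_ball x -> u x = 0].

Definition locally_lipschitz_on (R : realType) (A : set R) (f : R -> R) : Prop :=
  forall t, A t -> exists2 U, nbhs t U & [lipschitz f s | s in U `&` A].

Definition radially_symmetric_on (R : realType) (n : nat) (A : set 'rV[R]_n)
    (v : 'rV[R]_n -> R) : Prop :=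
  forall x y, A x -> A y -> enorm x = enorm y -> v x = v y.

Definition radially_decreasing_on (R : realType) (n : nat) (A : set 'rV[R]_n)
    (v : 'rV[R]_n -> R) : Prop :=
  forall x y, A x -> A y -> enorm x < enorm y -> v y <= v x.

Definition radially_strictly_decreasing_on (R : realType) (n : nat)
    (A : set 'rV[R]_n) (v : 'rV[R]_n -> R) : Prop :=
  forall x y, A x -> A y -> enorm x < enorm y -> v y < v x.

(* Main.v *)
Require Import Defs.
From mathcomp Require Import all_boot all_order all_algebra.
From mathcomp Require Import all_classical all_reals all_analysis.
From mathcomp Require Import measurable_realfun.
From mathcomp Require Import ring lra.

Import Order.TTheory GRing.Theory Num.Theory.
Import numFieldNormedType.Exports.

Set Implicit Arguments.
Unset Strict Implicit.
Unset Printing Implicit Defensive.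

Local Open Scope classical_set_scope.
Local Open Scope ring_scope.

(** The proof is the method of moving planes, run directly on pointwise values
    of the operator.

    Fix a unit vector e and let w_l(y) = u(y') - u(y), where y' = mirror e l y
    is the reflection of y in the hyperplane at signed distance l from the
    origin.  The goal is that w_l >= 0 on the cap { l <= y.e } for all l > 0,
    with w_l > 0 inside the ball.  This suffices: two points x, y are exchanged
    by the reflection in their bisector, which has l > 0 when y is the farther
    one, so u(y) < u(x); and when |x| = |y| one lets l decrease to 0 and
    exchanges the roles of x and y.

    The only integral estimate is op_mirror_le.  If w_l(x) <= 0 is the minimum
    of w_l on the cap, a reflection of the integration variable turns
    Lu(x') - Lu(x) into the principal value of
      (w_l(x) - w_l(y)) (K(x - y) - K(x - y')) + 2 w_l(x) K(x - y')
    over the cap, where both terms are nonpositive because K decreases along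
    rays and x is closer to y than to y'.  Any set on which the integrand is
    bounded away from 0 therefore gives a negative upper bound.  On the other
    side, the equation, the monotonicity of g and the Lipschitz bound for f give
    Lu(x') - Lu(x) >= - C |w_l(x)|.

    Two consequences follow.  If w_l(x) < 0, the second term, evaluated near x,
    has size |w_l(x)| times a negative power of the distance from x to the
    plane, so this distance is bounded below by a constant d0 that depends
    neither on l nor on x (negative_min_far).  If w_l(x) = 0 with x in the ball,
    the first term must vanish; but at the boundary point x/|x|, which lies
    within distance 1 of x, w_l is positive and K is strictly decreasing
    (zero_min_op_lt).

    Now let l0 be the supremum of the l for which w_l is negative somewhere on
    its cap.  By continuity w_l0 >= 0, hence w_l0 > 0 on the part of the closed
    ball at distance at least d0/2 beyond the plane, and by compactness this
    persists for l near l0.  But for l slightly below l0 a negative minimum lies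
    at distance at least d0 from its plane, in that compact part: a
    contradiction (w_ge0).

    The change of variables rests on the invariance of Lebesgue measure under
    reflections, which comes from translation invariance by the uniqueness
    argument for Haar measure (lebesgue_rV_isometry). *)

(** * Lebesgue measure: translations and isometries *)

Lemma lebesgue_measure_shift (R : realType) (t : R)
    (A : set (measurableTypeR R)) :
  measurable A ->
  lebesgue_measure ((fun x => x + t) @^-1` A) = lebesgue_measure A.
Proof.
have mt : measurable_fun setT
    ((fun x => x + t) : measurableTypeR R -> measurableTypeR R).
  exact: measurable_funD.
move=> mA.
pose m := pushforward (@lebesgue_measure R)
  ((fun x => x + t) : measurableTypeR R -> measurableTypeR R).
rewrite -[LHS]/(m A); apply/esym/lebesgue_measure_unique => //= _ [[a b]] _ <-.
transitivity (@lebesgue_measure R `](a - t), (b - t)]%classic).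
  rewrite !lebesgue_measure_itv/= !lte_fin ltrD2r.
  by case: ifP => // _; rewrite -!EFinB; congr EFin; ring.
rewrite /m /pushforward; congr lebesgue_measure.
by apply/seteqP; split => x /=; rewrite !in_itv/= ltrBlDr lerBrDr.
Qed.

Section rV_measurability.
Context {R : realType} {n : nat}.

Lemma measurable_rV_add d (T : measurableType d) (f g : T -> 'rV[R]_n) :
  measurable_fun setT f -> measurable_fun setT g ->
  measurable_fun setT (fun x => f x + g x).
Proof.
move=> mf mg; apply: measurable_fun_rVP => i.
rewrite (_ : _ \o _ = (rV_coord i \o f) \+ (rV_coord i \o g)); last first.
  by apply/funext => x; rewrite /= /rV_coord mxE.
by apply: measurable_funD; apply: measurableT_comp => //;
  exact: measurable_rV_coord.
Qed.

Lemma measurable_rV_scale d (T : measurableType d) (f : T -> R)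
    (g : T -> 'rV[R]_n) :
  measurable_fun setT f -> measurable_fun setT g ->
  measurable_fun setT (fun x => f x *: g x).
Proof.
move=> mf mg; apply: measurable_fun_rVP => i.
rewrite (_ : _ \o _ = f \* (rV_coord i \o g)); last first.
  by apply/funext => x; rewrite /= /rV_coord mxE.
apply: measurable_funM => //; apply: measurableT_comp => //.
exact: measurable_rV_coord.
Qed.

Lemma measurable_rV_opp d (T : measurableType d) (f : T -> 'rV[R]_n) :
  measurable_fun setT f -> measurable_fun setT (fun x => - f x).
Proof.
move=> mf; rewrite (_ : (fun x => _) = fun x => (cst (-1) x : R) *: f x).
  exact: measurable_rV_scale.
by apply/funext => x; rewrite scaleN1r.
Qed.

Lemma measurable_enorm : measurable_fun [set: 'rV[R]_n] (@enorm R n).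
Proof.
rewrite (_ : @enorm R n = Num.sqrt \o (fun x => \sum_i rV_coord i x ^+ 2))//.
apply: measurableT_comp.
  by apply: continuous_measurable_fun; exact: sqrt_continuous.
apply: measurable_sum => i; apply: measurable_funX.
exact: measurable_rV_coord.
Qed.

Definition cube (x : 'rV[R]_n) (r : R) : set 'rV[R]_n :=
  [set y | forall i, `|y ord0 i - x ord0 i| <= r].

Lemma measurable_cube (x : 'rV[R]_n) (r : R) : measurable (cube x r).
Proof.
rewrite (_ : cube x r = \big[setI/setT]_(i < n)
    (rV_coord i @^-1` `[x ord0 i - r, x ord0 i + r])); last first.
  rewrite -bigcap_seq; apply/seteqP; split => y /= yr i.
    by move=> _ /=; rewrite in_itv/= -ler_distl; exact: yr.
  by have := yr i; rewrite /= mem_index_enum in_itv/= -ler_distl; apply.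
apply: bigsetI_measurable => i _; rewrite -[X in measurable X]setTI.
exact: measurable_rV_coord.
Qed.

Lemma lebesgue_cube (x : 'rV[R]_n) (r : R) : 0 <= r ->
  lebesgue_rV (cube x r) = ((2 * r) ^+ n)%:E.
Proof.
move=> r0; rewrite (_ : cube x r = [set y | forall i,
   [set` `[x ord0 i - r, x ord0 i + r]] (rV_coord i y)]); last first.
  by apply/seteqP; split => y /= yr i; have := yr i;
     rewrite in_itv/= -ler_distl.
rewrite (lebesgue_rV_box (A := fun i => [set` `[x ord0 i - r, x ord0 i + r]]))//.
under eq_bigr => i _.
  rewrite lebesgue_measure_itv/= lte_fin.
  rewrite (_ : (if _ then _ else _) = (2 * r)%:E); last first.
    case: ltP => [_|]; first by rewrite -EFinD; congr EFin; ring.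
    by move=> ?; congr EFin; lra.
  over.
by rewrite prodEFin prodr_const card_ord.
Qed.

End rV_measurability.

(** Induction on the dimension: on a product of measurable sets the shifted
    measure factors, and a product measure is determined by its values on
    rectangles. *)
Lemma lebesgue_rV_shift (R : realType) (n : nat) (t : 'rV[R]_n)
    (A : set 'rV[R]_n) : measurable A ->
  lebesgue_rV ((fun x => x + t) @^-1` A) = lebesgue_rV A.
Proof.
elim: n t A => [|n IH] t A mA.
  by rewrite (_ : (fun x => _) = id)//; apply/funext => x; apply/rowP => -[].
pose a := t ord0 ord0; pose s := \row_i t ord0 (lift ord0 i).
pose h (p : measurableTypeR R * 'rV[R]_n) :
  measurableTypeR R * 'rV[R]_n := (p.1 + a, p.2 + s).
have mh : measurable_fun setT h.
  apply/measurable_fun_pairP; split; first exact: measurable_funD.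
  by apply: measurable_rV_add.
have consh p : cons_rV (h p) = cons_rV p + t.
  apply/rowP => i; rewrite /cons_rV !mxE.
  have [j ->|->] := unliftP ord0 i; last by [].
  by rewrite /= !mxE.
rewrite /= /pushforward.
have mB : measurable (@cons_rV R n @^-1` A).
  by rewrite -[X in measurable X]setTI; exact: measurable_cons_rV.
rewrite (_ : _ @^-1` _ = h @^-1` (@cons_rV R n @^-1` A)); last first.
  by apply/seteqP; split => p /=; rewrite consh.
pose prod := (@lebesgue_measure R \x @lebesgue_rV R n)%E.
apply/esym/(product_measure_unique (m' := pushforward prod h)) => // X Y mX mY.
transitivity (prod (((fun x => x + a) @^-1` X) `*` ((fun x => x + s) @^-1` Y))).
  by [].
rewrite /prod product_measure1E//.
- congr (_ * _)%E; [exact: lebesgue_measure_shift mX|exact: IH].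
- rewrite -[X in measurable X]setTI.
  by apply: (measurable_funD (f := id) (g := cst a)).
- by rewrite -[X in measurable X]setTI; apply: measurable_rV_add.
Qed.

Section enorm_cubes.
Context {R : realType} {n : nat}.
Implicit Types (x y : 'rV[R]_n) (r : R).

Lemma enorm_ge0 x : 0 <= enorm x.
Proof. exact: sqrtr_ge0. Qed.

Lemma sqr_enorm x : enorm x ^+ 2 = \sum_i x ord0 i ^+ 2.
Proof. by rewrite sqr_sqrtr// sumr_ge0// => i _; exact: sqr_ge0. Qed.

Lemma coord_le_enorm x i : `|x ord0 i| <= enorm x.
Proof.
rewrite -(@ler_pXn2r _ 2) ?nnegrE ?enorm_ge0// sqr_enorm real_normK ?num_real//.
by rewrite (bigD1 i)//= lerDl sumr_ge0// => j _; exact: sqr_ge0.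
Qed.

(** The side n.+1 instead of the sharp square root of n gives a strict
    inequality, and covers n = 0. *)
Lemma cube_lt_enorm x r : 0 < r ->
  (forall i, `|x ord0 i| <= r / n.+1%:R) -> enorm x < r.
Proof.
move=> r0 xr; rewrite -(@ltr_pXn2r _ 2) ?nnegrE ?enorm_ge0 ?(ltW r0)//.
rewrite sqr_enorm.
apply: (@le_lt_trans _ _ (\sum_(i < n) (r / n.+1%:R) ^+ 2)).
  apply: ler_sum => i _; rewrite -[leLHS]real_normK ?num_real//.
  by rewrite ler_pXn2r ?nnegrE ?divr_ge0 ?(ltW r0).
rewrite sumr_const card_ord expr_div_n -[ltLHS]mulr_natr -mulrA gtr_pMr ?exprn_gt0//.
rewrite mulrC ltr_pdivrMr ?exprn_gt0// mul1r -natrX ltr_nat.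
by rewrite expnS expn1 (leq_trans (ltnSn n))// leq_pmull.
Qed.

Lemma measurable_enorm_ball x r : measurable [set y : 'rV[R]_n | enorm (y - x) < r].
Proof.
rewrite (_ : mkset _ = (fun y => enorm (y - x)) @^-1` [set` `]-oo, r[%R]); last first.
  by apply/seteqP; split => y /=; rewrite in_itv.
rewrite -[X in measurable X]setTI.
apply: (measurableT_comp (@measurable_enorm R n)) => //.
exact: measurable_rV_add.
Qed.

(** Balls are the test sets of the Haar uniqueness argument: their measure has
    to be finite and nonzero so that it can be cancelled. *)
Lemma enorm_ball_fin_pos x : exists2 c : R, 0 < c &
  lebesgue_rV [set y | enorm (y - x) < 1] = c%:E.
Proof.
pose B := [set y : 'rV[R]_n | enorm (y - x) < 1].
have mB : measurable B := measurable_enorm_ball x 1.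
have Bfin : (lebesgue_rV B < +oo)%E.
  apply: le_lt_trans (ltry ((2 * 1) ^+ n)).
  rewrite -(lebesgue_cube x ler01); apply: le_measure; rewrite ?inE//.
    exact: measurable_cube.
  move=> y /= yx i; have := coord_le_enorm (y - x) i; rewrite !mxE => /le_trans.
  by apply; exact: ltW.
have Bpos : (0 < lebesgue_rV B)%E.
  have r0 : 0 <= n.+1%:R^-1 :> R by [].
  apply: (@lt_le_trans _ _ ((2 * n.+1%:R^-1) ^+ n)%:E).
    by rewrite lte_fin exprn_gt0// mulr_gt0.
  rewrite -(lebesgue_cube x r0); apply: le_measure; rewrite ?inE//.
    exact: measurable_cube.
  move=> y /= yx; apply: cube_lt_enorm => // i; rewrite !mxE div1r; exact: yx.
exists (fine (lebesgue_rV B)).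
  by rewrite fine_gt0// Bpos Bfin.
by rewrite fineK// ge0_fin_numE// ltW.
Qed.

End enorm_cubes.

Lemma ge0_integral_rV_shift (R : realType) (n : nat) (t : 'rV[R]_n)
    (f : 'rV[R]_n -> \bar R) :
  measurable_fun setT f -> (forall x, 0 <= f x)%E ->
  (\int[@lebesgue_rV R n]_x f (x + t)%R = \int[@lebesgue_rV R n]_x f x)%E.
Proof.
move=> mf f0.
have mt : measurable_fun setT (fun x : 'rV[R]_n => x + t).
  exact: measurable_rV_add.
pose h (x : 'rV[R]_n) := x + t.
rewrite -[LHS]/(\int[@lebesgue_rV R n]_(x in h @^-1` setT) (f \o h) x)%E.
rewrite -ge0_integral_pushforward//.
apply: eq_measure_integral => A mA _; exact: lebesgue_rV_shift.
Qed.

(** Uniqueness of Haar measure, run by hand for A |-> |s^-1(A)|.  The hypothesis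
    on t says that s intertwines the translation by t y with the translation by
    y, as an affine bijection s does when t is the inverse of its linear part.
    Two applications of Tonelli to a shifted product of indicators give
    |s^-1(A)| |C| = |A| |{x : - s x \in C}|.  When s preserves the distance to p
    and C is the unit ball around - p, the last factor is the measure of the
    unit ball around p, which equals |C|. *)
Lemma lebesgue_rV_isometry (R : realType) (n : nat) (s t : 'rV[R]_n -> 'rV[R]_n)
    (p : 'rV[R]_n) (A : set 'rV[R]_n) :
  measurable_fun setT s ->
  (forall x y, s (x + t y) = s x + y) ->
  (forall x, enorm (s x - p) = enorm (x - p)) ->
  measurable A -> lebesgue_rV (s @^-1` A) = lebesgue_rV A.
Proof.
move=> ms st sp mA.
have msA : measurable (s @^-1` A) by rewrite -[X in measurable X]setTI; exact: ms.
pose C := [set y : 'rV[R]_n | enorm (y - - p) < 1].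
have mC : measurable C := measurable_enorm_ball _ _.
have [c c0 Cc] := enorm_ball_fin_pos (- p).
have mI1 B (f : 'rV[R]_n -> 'rV[R]_n) : measurable B ->
    measurable_fun setT f -> measurable_fun setT (fun x => (\1_B (f x) : R)).
  by move=> mB mf; apply: measurableT_comp => //; exact: measurable_indic.
have mI2 B (f : ('rV[R]_n * 'rV[R]_n)%type -> 'rV[R]_n) : measurable B ->
    measurable_fun setT f -> measurable_fun setT (fun x => (\1_B (f x) : R)).
  by move=> mB mf; apply: measurableT_comp => //; exact: measurable_indic.
pose L := @lebesgue_rV R n.
have step1 : (lebesgue_rV (s @^-1` A) * c%:E =
   \int[L]_y \int[L]_x (\1_A (s x) * \1_C y : R)%:E)%E.
  under eq_integral => y _.
    under eq_integral do rewrite EFinM.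
    rewrite ge0_integralZr//; last by apply/measurable_EFinP; exact: mI1.
    rewrite (integral_indic _ measurableT msA) setIT.
    over.
  rewrite ge0_integralZl//; last first.
    by apply/measurable_EFinP; exact: measurable_indic.
  by rewrite integral_indic// setIT; congr (_ * _)%E; exact/esym/Cc.
have step2 : (\int[L]_y \int[L]_x (\1_A (s x) * \1_C y : R)%:E =
   \int[L]_y \int[L]_x (\1_A (s x + y)%R * \1_C y : R)%:E)%E.
  apply: eq_integral => y _.
  rewrite -(ge0_integral_rV_shift (t y)); last 2 first.
  - by apply/measurable_EFinP; apply: measurable_funM => //; exact: mI1.
  - by move=> x; rewrite /= lee_fin mulr_ge0.
  by apply: eq_integral => x _; rewrite st.
have step3 : (\int[L]_y \int[L]_x (\1_A (s x + y)%R * \1_C y : R)%:E =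
   \int[L]_x \int[L]_y (\1_A (s x + y)%R * \1_C y : R)%:E)%E.
  pose F z := ((\1_A (s z.1 + z.2) * \1_C z.2 : R)%:E).
  apply/esym; apply: (fubini_tonelli (m1 := L) (m2 := L) F); last first.
    by move=> z; rewrite /F lee_fin mulr_ge0.
  apply/measurable_EFinP; apply: measurable_funM; last exact: (mI2 C snd mC).
  apply: (mI2 A (fun z => s z.1 + z.2) mA).
  apply: measurable_rV_add; last exact: measurable_snd.
  exact: (measurableT_comp ms measurable_fst).
have step4 : (\int[L]_x \int[L]_y (\1_A (s x + y)%R * \1_C y : R)%:E =
   \int[L]_x \int[L]_y (\1_A y * \1_C (y - s x)%R : R)%:E)%E.
  apply: eq_integral => x _.
  rewrite -[RHS](ge0_integral_rV_shift (s x)); last 2 first.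
  - apply/measurable_EFinP; apply: measurable_funM; first exact: (mI1 A id mA).
    by apply: (mI1 C (fun y => y - s x) mC); exact: measurable_rV_add.
  - by move=> y; rewrite /= lee_fin mulr_ge0.
  by apply: eq_integral => y _; rewrite addrK addrC.
have step5 : (\int[L]_x \int[L]_y (\1_A y * \1_C (y - s x)%R : R)%:E =
   \int[L]_y \int[L]_x (\1_A y * \1_C (y - s x)%R : R)%:E)%E.
  pose F z := ((\1_A z.2 * \1_C (z.2 - s z.1) : R)%:E).
  apply: (fubini_tonelli (m1 := L) (m2 := L) F); last first.
    by move=> z; rewrite /F lee_fin mulr_ge0.
  apply/measurable_EFinP; apply: measurable_funM; first exact: (mI2 A snd mA).
  apply: (mI2 C (fun z => z.2 - s z.1) mC).
  apply: measurable_rV_add; first exact: measurable_snd.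
  by apply: measurable_rV_opp; exact: (measurableT_comp ms measurable_fst).
have step6 : (\int[L]_y \int[L]_x (\1_A y * \1_C (y - s x)%R : R)%:E =
   \int[L]_y ((\1_A y : R)%:E * c%:E))%E.
  apply: eq_integral => y _.
  under eq_integral do rewrite EFinM.
  have mCs : measurable_fun setT (fun x => ((\1_C (y - s x) : R)%:E)).
    apply/measurable_EFinP; apply: (mI1 C (fun x => y - s x) mC).
    by apply: measurable_rV_add; [exact: measurable_cst|exact: measurable_rV_opp].
  rewrite (ge0_integralZl _ measurableT mCs); last 2 first.
  - by move=> x _; rewrite lee_fin.
  - by rewrite lee_fin.
  congr (_ * _)%E.
  rewrite -(ge0_integral_rV_shift (t y) mCs); last by move=> x; rewrite lee_fin.
  under eq_integral => x _ do rewrite st opprD addrCA subrr addr0.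
  transitivity (\int[L]_x (\1_[set x | (enorm (x - p) < 1)%R] x : R)%:E)%E.
    apply: eq_integral => x _; rewrite !indicE.
    have E : enorm (- s x - - p) = enorm (x - p).
      rewrite -sp /enorm; congr Num.sqrt; apply: eq_bigr => i _.
      by rewrite !mxE; ring.
    congr ((nat_of_bool _)%:R%:E).
    by apply/idP/idP; rewrite !inE /C /= E.
  rewrite (integral_indic _ measurableT (measurable_enorm_ball p 1)) setIT.
  rewrite -Cc -[RHS](lebesgue_rV_shift (- p - p) mC).
  by congr lebesgue_rV; apply/seteqP; split => x;
    rewrite /C /= opprK addrA subrK.
have cE : (c%:E * lebesgue_rV (s @^-1` A) = c%:E * lebesgue_rV A)%E.
  rewrite muleC step1 step2 step3 step4 step5 step6.
  have mIA : measurable_fun setT (fun x => ((\1_A x : R)%:E)).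
    by apply/measurable_EFinP; exact: measurable_indic.
  rewrite (ge0_integralZr _ measurableT mIA); last 2 first.
  - by move=> x _; rewrite lee_fin.
  - by rewrite lee_fin ltW.
  by rewrite (integral_indic _ measurableT mA) setIT muleC.
have cVc : (c^-1%:E * c%:E = 1)%E by rewrite -EFinM mulVf ?gt_eqF.
by rewrite -[LHS]mul1e -[RHS]mul1e -cVc -!muleA cE.
Qed.

(** * Euclidean geometry and reflections in hyperplanes *)

Section dot_product.
Context {R : realType} {n : nat}.
Implicit Types (x y z e : 'rV[R]_n) (a l : R).

Definition dotv x y : R := \sum_i x ord0 i * y ord0 i.

Lemma dotvC x y : dotv x y = dotv y x.
Proof. by apply: eq_bigr => i _; rewrite mulrC. Qed.

Lemma dotvDl x y z : dotv (x + y) z = dotv x z + dotv y z.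
Proof. by rewrite -big_split; apply: eq_bigr => i _; rewrite mxE mulrDl. Qed.

Lemma dotvZl a x z : dotv (a *: x) z = a * dotv x z.
Proof. by rewrite mulr_sumr; apply: eq_bigr => i _; rewrite mxE mulrA. Qed.

Lemma dotvNl x z : dotv (- x) z = - dotv x z.
Proof. by rewrite -scaleN1r dotvZl mulN1r. Qed.

Lemma dotvBl x y z : dotv (x - y) z = dotv x z - dotv y z.
Proof. by rewrite dotvDl dotvNl. Qed.

Lemma dotvDr x y z : dotv z (x + y) = dotv z x + dotv z y.
Proof. by rewrite !(dotvC z) dotvDl. Qed.

Lemma dotvZr a x z : dotv z (a *: x) = a * dotv z x.
Proof. by rewrite !(dotvC z) dotvZl. Qed.

Lemma dotvBr x y z : dotv z (x - y) = dotv z x - dotv z y.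
Proof. by rewrite !(dotvC z) dotvBl. Qed.

Lemma dotvNr x z : dotv z (- x) = - dotv z x.
Proof. by rewrite !(dotvC z) dotvNl. Qed.

Definition dotvE := (dotvDl, dotvDr, dotvNl, dotvNr, dotvZl, dotvZr).

Lemma enorm_dotv x : enorm x ^+ 2 = dotv x x.
Proof. by rewrite sqr_enorm; apply: eq_bigr => i _; rewrite expr2. Qed.

Lemma enormZ a x : enorm (a *: x) = `|a| * enorm x.
Proof.
apply/eqP; rewrite -(@eqrXn2 _ 2) ?mulr_ge0 ?enorm_ge0//.
by rewrite exprMn !enorm_dotv dotvZl dotvZr real_normK ?num_real// mulrA -expr2.
Qed.

Lemma enormN x : enorm (- x) = enorm x.
Proof. by rewrite -scaleN1r enormZ normrN1 mul1r. Qed.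

Lemma enormBC x y : enorm (x - y) = enorm (y - x).
Proof. by rewrite -enormN opprB. Qed.

Lemma enorm_eq0 x : enorm x = 0 -> x = 0.
Proof.
move=> x0; apply/rowP => i; rewrite mxE; apply/eqP.
by rewrite -normr_eq0 eq_le normr_ge0 andbT -x0 coord_le_enorm.
Qed.

Lemma enormB_gt0 x y : x != y -> 0 < enorm (x - y).
Proof.
move=> xy; rewrite lt_neqAle enorm_ge0 andbT; apply: contra xy => /eqP /esym.
by move=> /enorm_eq0 /eqP; rewrite subr_eq0.
Qed.

Lemma ler_enorm_sqr x y : enorm x ^+ 2 <= enorm y ^+ 2 -> enorm x <= enorm y.
Proof. by rewrite ler_pXn2r ?nnegrE ?enorm_ge0. Qed.

Lemma ltr_enorm_sqr x y : enorm x ^+ 2 < enorm y ^+ 2 -> enorm x < enorm y.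
Proof. by rewrite ltr_pXn2r ?nnegrE ?enorm_ge0. Qed.

(** Expanding |x - (x.e) e|^2 >= 0. *)
Lemma dotv_le_enorm x e : dotv e e = 1 -> `|dotv x e| <= enorm x.
Proof.
move=> e1; rewrite -(@ler_pXn2r _ 2) ?nnegrE ?enorm_ge0//.
rewrite real_normK ?num_real// enorm_dotv -subr_ge0.
have := sqr_ge0 (enorm (x - dotv x e *: e)).
rewrite enorm_dotv dotvBl dotvZl !dotvBr !dotvZr e1 (dotvC e x).
by move=> h; apply: le_trans h _; rewrite le_eqVlt; apply/orP; left; apply/eqP; ring.
Qed.

Lemma cvg_dotv T (F : set_system T) {FF : Filter F} (f g : T -> 'rV[R]_n) x y :
  f @ F --> x -> g @ F --> y -> dotv (f t) (g t) @[t --> F] --> dotv x y.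
Proof.
move=> fx gy; apply: cvg_big => [|i _]; first exact: add_continuous.
apply: cvgM.
  by apply: (cvg_comp _ (fun M : 'rV[R]_n => M ord0 i) fx); exact: coord_continuous.
by apply: (cvg_comp _ (fun M : 'rV[R]_n => M ord0 i) gy); exact: coord_continuous.
Qed.

Lemma cvg_enorm T (F : set_system T) {FF : Filter F} (f : T -> 'rV[R]_n) x :
  f @ F --> x -> enorm (f t) @[t --> F] --> enorm x.
Proof.
move=> fx; rewrite (_ : (fun t => _) = (fun t => Num.sqrt (dotv (f t) (f t)))).
  rewrite (_ : enorm x = Num.sqrt (dotv x x)).
    by apply: (cvg_comp _ _ (cvg_dotv fx fx)); exact: sqrt_continuous.
  by congr Num.sqrt; apply: eq_bigr => i _; rewrite expr2.
by apply/funext => t; congr Num.sqrt; apply: eq_bigr => i _; rewrite expr2.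
Qed.

Lemma measurable_dotv d (T : measurableType d) (f : T -> 'rV[R]_n) e :
  measurable_fun setT f -> measurable_fun setT (fun t => dotv (f t) e).
Proof.
move=> mf; rewrite /dotv; apply: measurable_sum => i.
apply: measurable_funM => //.
exact: (measurableT_comp (@measurable_rV_coord R n i) mf).
Qed.

(** For a unit vector e, the orthogonal reflection in { x | dotv x e = l }. *)
Definition mirror e l x := x + (2 * (l - dotv x e)) *: e.

Section unit_normal.
Variables (e : 'rV[R]_n) (l : R).
Hypothesis e1 : dotv e e = 1.

Lemma dotv_mirror x : dotv (mirror e l x) e = 2 * l - dotv x e.
Proof. by rewrite dotvDl dotvZl e1; ring. Qed.

Lemma mirrorK : involutive (mirror e l).
Proof.
by move=> x; rewrite {1}/mirror dotv_mirror -addrA -scalerDl [X in X *: _](_ : _ = 0)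
  ?scale0r ?addr0//; ring.
Qed.

Lemma enorm_mirrorB x y : enorm (mirror e l x - mirror e l y) = enorm (x - y).
Proof.
apply/eqP; rewrite -(@eqrXn2 _ 2) ?enorm_ge0//; apply/eqP.
rewrite (_ : _ - mirror e l y = (x - y) - (2 * dotv (x - y) e) *: e).
  by rewrite !enorm_dotv !dotvE !(dotvC e) e1; ring.
by apply/rowP => i; rewrite dotvBl !mxE; ring.
Qed.

Lemma enormB_mirror x y : enorm (mirror e l x - y) = enorm (x - mirror e l y).
Proof. by rewrite -{1}(mirrorK y) enorm_mirrorB. Qed.

Lemma sqr_enorm_mirror x :
  enorm (mirror e l x) ^+ 2 = enorm x ^+ 2 - 4 * l * (dotv x e - l).
Proof.
by rewrite !enorm_dotv /mirror !dotvE !(dotvC e) e1; ring.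
Qed.

(** The identity behind all comparisons of distances: for points on the same
    side of the plane, reflecting one of them increases the distance. *)
Lemma sqr_enormB_mirror x y : enorm (x - mirror e l y) ^+ 2 =
  enorm (x - y) ^+ 2 + 4 * (dotv x e - l) * (dotv y e - l).
Proof.
rewrite !enorm_dotv /mirror.
by rewrite !dotvE !(dotvC e) e1
  !(dotvC y x); ring.
Qed.

Lemma le_enormB_mirror x y : l <= dotv x e -> l <= dotv y e ->
  enorm (x - y) <= enorm (x - mirror e l y).
Proof.
move=> xl yl; apply: ler_enorm_sqr; rewrite sqr_enormB_mirror lerDl.
by rewrite !mulr_ge0// subr_ge0.
Qed.

(** y and its mirror image are separated by the plane, so that the kernel is
    bounded on the mirror image of the cap. *)
Lemma dist_le_enormB_mirror x y : l <= dotv y e ->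
  dotv x e - l <= enorm (x - mirror e l y).
Proof.
move=> yl; apply: le_trans (dotv_le_enorm _ e1); apply: le_trans (ler_norm _).
by rewrite dotvBl dotv_mirror; lra.
Qed.

Lemma mirror_fix x : dotv x e = l -> mirror e l x = x.
Proof. by move=> xl; rewrite /mirror xl subrr mulr0 scale0r addr0. Qed.

Lemma measurable_mirror : measurable_fun setT (mirror e l).
Proof.
apply: measurable_rV_add => //; apply: measurable_rV_scale => //.
apply: measurable_funM => //; apply: measurable_funB => //.
exact: measurable_dotv.
Qed.

Lemma lebesgue_rV_mirror (A : set 'rV[R]_n) : measurable A ->
  lebesgue_rV (mirror e l @^-1` A) = lebesgue_rV A.
Proof.
apply: (@lebesgue_rV_isometry _ _ _ (mirror e 0) (l *: e)) => [|x y|x].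
- exact: measurable_mirror.
(* mirror e 0 is the linear part of mirror e l, and its own inverse *)
- by apply/rowP => i; rewrite /mirror !dotvDl dotvZl e1 !mxE; ring.
(* the centre l *: e lies on the plane *)
- rewrite -{1}(@mirror_fix (l *: e)) ?enorm_mirrorB//.
  by rewrite dotvZl e1 mulr1.
Qed.

Lemma integrable_mirror (h : 'rV[R]_n -> R) :
  (@lebesgue_rV R n).-integrable setT (EFin \o h) ->
  (@lebesgue_rV R n).-integrable setT (EFin \o (h \o mirror e l)).
Proof.
move=> /integrableP[mh hfin]; apply/integrableP; split.
  exact: (measurableT_comp mh measurable_mirror).
apply: le_lt_trans hfin.
have mah : measurable_fun setT (abse \o (EFin \o h)) by exact: measurableT_comp.
rewrite -[leLHS]/(\int[@lebesgue_rV R n]_(x in mirror e l @^-1` setT)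
  ((abse \o (EFin \o h)) \o mirror e l) x)%E.
rewrite -(ge0_integral_pushforward measurable_mirror _ measurableT mah).
  rewrite le_eqVlt; apply/orP; left; apply/eqP.
  apply: eq_measure_integral; first exact: measurable_mirror.
  by move=> ? A mA _; exact: lebesgue_rV_mirror.
by move=> y _; exact: abse_ge0.
Qed.

Lemma Rintegral_mirror (h : 'rV[R]_n -> R) :
  (@lebesgue_rV R n).-integrable setT (EFin \o h) ->
  \int[@lebesgue_rV R n]_x h (mirror e l x) = \int[@lebesgue_rV R n]_x h x.
Proof.
move=> ih; rewrite /Rintegral; congr fine.
rewrite -[LHS]/(\int[@lebesgue_rV R n]_(x in mirror e l @^-1` setT)
  ((EFin \o h) \o mirror e l) x)%E.
rewrite -(integral_pushforward measurable_mirror) //.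
- apply: eq_measure_integral; first exact: measurable_mirror.
  by move=> ? A mA _; exact: lebesgue_rV_mirror.
- exact: measurable_int ih.
- exact: integrable_mirror.
Qed.

End unit_normal.

Lemma cvg_mirror e T (F : set_system T) {FF : Filter F} (f : T -> R)
    (g : T -> 'rV[R]_n) l x :
  f @ F --> l -> g @ F --> x ->
  mirror e (f t) (g t) @[t --> F] --> mirror e l x.
Proof.
move=> fl gx; apply: cvgD; first exact: gx.
apply: cvgZ; last exact: cvg_cst.
apply: cvgM; first exact: cvg_cst.
by apply: cvgB; first exact: fl; apply: cvg_dotv; [exact: gx|exact: cvg_cst].
Qed.

End dot_product.

(** * The radial profile of the kernel *)

Definition kernel_profile (R : realType) (n : nat) (mu a1 a2 r : R) : R :=
  if r < 1 then 1 / r `^ (n%:R + 2 * a1) else mu / r `^ (n%:R + 2 * a2).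

Section kernel_profile.
Context {R : realType} (n : nat) (mu a1 a2 : R).
Hypotheses (mu01 : 0 <= mu <= 1) (a1_01 : 0 < a1 < 1) (a2_01 : 0 < a2 < 1).
Local Notation K := (kernel_profile n mu a1 a2).

Lemma kernel_profile_ge0 r : 0 <= K r.
Proof.
rewrite /kernel_profile; case: ifP => _; apply: divr_ge0 => //; last exact: powR_ge0.
  exact: powR_ge0.
by case/andP: mu01.
Qed.

Let p1 : 0 < n%:R + 2 * a1.
Proof. by rewrite ltr_wpDl// mulr_gt0//; case/andP: a1_01. Qed.

Let p2 : 0 < n%:R + 2 * a2.
Proof. by rewrite ltr_wpDl// mulr_gt0//; case/andP: a2_01. Qed.

(** Across r = 1 the profile passes from values >= 1 to values <= mu <= 1: this
    is where mu <= 1 is used.  At r = 0 the profile takes the value 0, hence the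
    restriction to r > 0. *)
Lemma kernel_profile_anti r s : 0 < r -> r <= s -> K s <= K r.
Proof.
move=> r0 rs; have s0 := lt_le_trans r0 rs.
case/andP: mu01 => mu0 mu1; rewrite /kernel_profile.
case: (ltP s 1) => s1.
  rewrite (le_lt_trans rs s1) !div1r lef_pV2 ?posrE ?powR_gt0//.
  by apply: ge0_ler_powR => //; rewrite ?nnegrE ltW.
case: (ltP r 1) => r1.
  apply: (@le_trans _ _ 1).
    rewrite ler_pdivrMr ?powR_gt0// mul1r; apply: le_trans mu1 _.
    by rewrite -[leLHS](powRr0 s); apply: (ler_powR s1); exact: ltW p2.
  rewrite ler_pdivlMr ?powR_gt0// mul1r.
  rewrite -[leRHS](congr1 (@^~ (n%:R + 2 * a1)) (powR1 R)).
  by apply: ge0_ler_powR; rewrite ?nnegrE ?ler01// ltW.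
apply: ler_wpM2l => //; rewrite lef_pV2 ?posrE ?powR_gt0//.
by apply: ge0_ler_powR => //; rewrite ?nnegrE ltW.
Qed.

Lemma kernel_profile_strict_anti r s : 0 < r -> r < s -> s < 1 -> K s < K r.
Proof.
move=> r0 rs s1; have s0 := lt_trans r0 rs.
rewrite /kernel_profile s1 (lt_trans rs s1) !div1r ltf_pV2 ?posrE ?powR_gt0//.
by apply: gt0_ltr_powR => //; rewrite ?nnegrE ltW.
Qed.

Lemma kernel_profile_near0 r : 0 < r < 1 ->
  K r = (r ^+ n * r `^ (2 * a1))^-1.
Proof.
move=> /andP[r0 r1]; rewrite /kernel_profile r1 div1r powRD ?powR_mulrn ?ltW//.
by rewrite gt_eqF ?implybT.
Qed.

End kernel_profile.

(** * The operator at mirror points *)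

Lemma integrable_indic_fin d (T : measurableType d) (R : realType)
    (m : {measure set T -> \bar R}) (A : set T) (r : R) :
  measurable A -> m A = r%:E -> m.-integrable setT (EFin \o \1_A).
Proof.
move=> mA mAr; apply/integrableP; split.
  by apply/measurable_EFinP; exact: measurable_indic.
rewrite (eq_integral (fun x => (\1_A x)%:E)); last first.
  by move=> t _; rewrite gee0_abs// lee_fin.
by rewrite (integral_indic _ measurableT mA) setIT mAr ltry.
Qed.

Lemma Rintegral_indic_fin d (T : measurableType d) (R : realType)
    (m : {measure set T -> \bar R}) (A : set T) (r : R) :
  measurable A -> m A = r%:E -> \int[m]_x (\1_A x : R) = r.
Proof.
move=> mA mAr; rewrite /Rintegral (integral_indic _ measurableT mA) setIT.
by rewrite mAr.
Qed.

Lemma le_halve (R : realFieldType) (d q a b : R) :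
  d + d <= a * q + a * q - b -> d <= a * q - b / 2.
Proof. by move=> h; lra. Qed.

Section operator_comparison.
Context {R : realType} {n : nat} (mu a1 a2 : R) (u : 'rV[R]_n -> R).
Hypotheses (mu01 : 0 <= mu <= 1) (a1_01 : 0 < a1 < 1) (a2_01 : 0 < a2 < 1).
Variables (e : 'rV[R]_n) (l : R).
Hypotheses (e1 : dotv e e = 1) (n0 : (0 < n)%N).
Local Notation K := (kernel_profile n mu a1 a2).
Local Notation refl := (mirror e l).
Let w (y : 'rV[R]_n) := u (refl y) - u y.
Let L := @lebesgue_rV R n.

Lemma measurable_outside_ball (x : 'rV[R]_n) eps : measurable (outside_ball x eps).
Proof.
rewrite (_ : outside_ball x eps =
    (fun y => enorm (x - y)) @^-1` [set` `]eps, +oo[%R]); last first.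
  by apply/seteqP; split => y /=; rewrite in_itv/= andbT.
rewrite -[X in measurable X]setTI.
apply: (measurableT_comp (@measurable_enorm R n)) => //.
by apply: measurable_rV_add; [exact: measurable_cst|exact: measurable_rV_opp].
Qed.

Variable x0 : 'rV[R]_n.
Hypothesis x0l : l < dotv x0 e.
Hypothesis def0 : op_defined mu a1 a2 u x0.
Hypothesis def1 : op_defined mu a1 a2 u (refl x0).

(** The integrand extended by 0, to integrate over the whole space. *)
Let F eps x := (op_integrand mu a1 a2 u x \_ (outside_ball x eps)).

Let FE eps x y : F eps x y =
  if eps < enorm (x - y) then (u x - u y) * K (enorm (x - y)) else 0.
Proof.
rewrite /F patchE; case: ifPn => [|]; first by rewrite inE /= /outside_ball /= => ->.
by rewrite notin_setE /outside_ball /= => /negP/negPf ->.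
Qed.

Let iF eps x : 0 < eps -> op_defined mu a1 a2 u x ->
  L.-integrable setT (EFin \o F eps x).
Proof.
move=> eps0 [ix _]; rewrite -restrict_EFin.
by apply/(integrable_mkcond _ (measurable_outside_ball x eps)); exact: ix.
Qed.

(** The sum of the difference of the two truncated integrands at y and at its
    mirror image.  The arrangement is the one in which linearity of the integral
    and mirror invariance apply to it; on the right-hand side, only the values
    of w are left. *)
Let sym_sum eps y : F eps (refl x0) (refl y) - F eps x0 y
    + (F eps (refl x0) y - F eps x0 (refl y)) =
  (if eps < enorm (x0 - y) then (w x0 - w y) * K (enorm (x0 - y)) else 0) +
  (if eps < enorm (x0 - refl y)
   then (w x0 + w y) * K (enorm (x0 - refl y)) else 0).
Proof.
rewrite !FE enorm_mirrorB// !enormB_mirror// /w.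
move: (K (enorm (x0 - y))) (K (enorm (x0 - refl y))) => A B.
move: (u y) (u x0) (u (refl y)) (u (refl x0)) => uy ux ury urx.
by case: ifP => _; case: ifP => _; ring.
Qed.

(** Averaging over y and its mirror image instead of splitting the space along
    the plane avoids showing that the plane is negligible.  The integrand of
    sym_sum is at most - c on G and at most 0 elsewhere, except for y or its
    image within eps of x0: there the singular term has been removed and what is
    left is bounded, since the image of the cap keeps a positive distance from
    x0.  These exceptional sets lie in cubes of side 2 eps, or in their mirror
    images, whose contribution vanishes as eps tends to 0.  The factor 1 / 2
    comes from the average. *)
Lemma op_mirror_le (G : set 'rV[R]_n) (m c M : R) :
  (forall y, w y <= M) -> 0 <= M ->
  w x0 <= 0 -> (forall y, l <= dotv y e -> w x0 <= w y) ->
  measurable G -> lebesgue_rV G = m%:E ->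
  (forall y, G y -> l < dotv y e) -> 0 <= c ->
  (forall y, G y -> y != x0 ->
     (w x0 - w y) * (K (enorm (x0 - y)) - K (enorm (x0 - refl y)))
     + 2 * w x0 * K (enorm (x0 - refl y)) <= - c) ->
  op mu a1 a2 u (refl x0) - op mu a1 a2 u x0 <= - (c * m / 2).
Proof.
move=> wM M0 wx0 wmin mG Gm Gl c0 Gc.
pose de := dotv x0 e - l.
have de0 : 0 < de by rewrite subr_gt0.
(* M bounds w, and K de bounds the kernel at the mirror image; the extra c
   absorbs the term - c * \1_G when G meets the removed ball *)
pose C := M * K de + c.
have Kge0 r : 0 <= K r by exact: kernel_profile_ge0.
have C0 : 0 <= C by rewrite addr_ge0// mulr_ge0.
have half eps y : 0 < eps < de -> l <= dotv y e ->
    F eps (refl x0) (refl y) - F eps x0 y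
    + (F eps (refl x0) y - F eps x0 (refl y)) <=
    C * \1_(cube x0 eps) y - c * \1_G y.
  move=> /andP[eps0 epsde] yl; rewrite sym_sum.
  have b_de := @dist_le_enormB_mirror _ _ e l e1 x0 y yl.
  have ab := le_enormB_mirror e1 (ltW x0l) yl.
  rewrite (lt_le_trans epsde b_de).
  have Kb : K (enorm (x0 - refl y)) <= K de by exact: kernel_profile_anti.
  have Kb0 := Kge0 (enorm (x0 - refl y)).
  have wy := wmin _ yl; have wyM := wM y.
  case: ifPn => [epsa|]; last first.
    rewrite -leNgt add0r => aeps.
    have -> : \1_(cube x0 eps) y = 1 :> R.
      rewrite indicE (_ : (_ \in _) = true)//; apply/mem_set => i.
      have := coord_le_enorm (y - x0) i; rewrite !mxE => /le_trans; apply.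
      by rewrite enormBC.
    have : (w x0 + w y) * K (enorm (x0 - refl y)) <= M * K de.
      apply: (@le_trans _ _ (M * K (enorm (x0 - refl y)))).
        by apply: ler_wpM2r => //; lra.
      exact: ler_wpM2l.
    have : c * \1_G y <= c.
      by rewrite ler_piMr// indicE; case: (_ \in _).
    rewrite /C; lra.
  have a0 : 0 < enorm (x0 - y) := lt_trans eps0 epsa.
  have Kab : K (enorm (x0 - refl y)) <= K (enorm (x0 - y)).
    exact: kernel_profile_anti.
  have Q0 : 0 <= C * \1_(cube x0 eps) y.
    by rewrite mulr_ge0// indicE; case: (_ \in _).
  have E (a b p q : R) : (a - b) * p + (a + b) * q = (a - b) * (p - q) + 2 * a * q.
    by ring.
  rewrite E [\1_G y]indicE; have [Gy|Gy] := boolP (y \in G).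
    have yx0 : y != x0.
      apply: contraTneq a0 => ->.
      by rewrite subrr -(scale0r (0 : 'rV[R]_n)) enormZ normr0 mul0r ltxx.
    apply: le_trans (Gc y (set_mem Gy) yx0) _.
    by rewrite mulr1 -[leLHS]add0r lerD2r.
  rewrite mulr0 subr0; apply: le_trans Q0; rewrite -[leRHS]addr0; apply: lerD.
    by rewrite mulr_le0_ge0 ?subr_ge0 ?subr_le0.
  apply: mulr_le0_ge0; last exact: Kb0.
  by apply: mulr_ge0_le0; [exact: ler0n|exact: wx0].
have full eps y : 0 < eps < de ->
    F eps (refl x0) (refl y) - F eps x0 y
    + (F eps (refl x0) y - F eps x0 (refl y)) <=
    C * \1_(cube x0 eps) y + C * \1_(cube x0 eps) (refl y) - c * \1_G y.
  move=> epsde; have ind0 (A : set 'rV[R]_n) z : 0 <= C * \1_A z.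
    by rewrite mulr_ge0// indicE; case: (_ \in _).
  have [yl|yl] := leP l (dotv y e).
    by apply: le_trans (half eps y epsde yl) _; rewrite lerD2r lerDl; exact: ind0.
  have ryl : l <= dotv (refl y) e by rewrite dotv_mirror//; lra.
  have h := half eps (refl y) epsde ryl.
  rewrite (mirrorK _ e1) in h.
  rewrite addrC in h.
  have -> : \1_G y = 0 :> R.
    rewrite indicE (_ : (_ \in _) = false)//; apply/negbTE/negP => /set_mem.
    by move=> /Gl; rewrite ltNge (ltW yl).
  rewrite mulr0 subr0; apply: le_trans h _.
  apply: (@le_trans _ _ (C * \1_(cube x0 eps) (refl y))); last first.
    by rewrite lerDr; exact: ind0.
  rewrite gerBl; apply: mulr_ge0; first exact: c0.
  by rewrite indicE; case: (_ \in _).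
have trunc eps : 0 < eps < de ->
    truncated_op mu a1 a2 u (refl x0) eps - truncated_op mu a1 a2 u x0 eps <=
    C * (2 * eps) ^+ n - c * m / 2.
  move=> /[dup] epsde /andP[eps0 _].
  have TE x : truncated_op mu a1 a2 u x eps = \int[L]_y F eps x y.
    exact: Rintegral_mkcond.
  rewrite !TE.
  have i0 := iF eps0 def0; have i1 := iF eps0 def1.
  have ir0 := integrable_mirror l e1 i0; have ir1 := integrable_mirror l e1 i1.
  have Qe := lebesgue_cube x0 (ltW eps0).
  have mQ := measurable_cube x0 eps.
  have iQ := integrable_indic_fin mQ Qe.
  have irQ := integrable_mirror l e1 iQ.
  have iG := integrable_indic_fin mG Gm.
  have IQ := Rintegral_indic_fin mQ Qe.
  have IG := Rintegral_indic_fin mG Gm.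
  have IrQ := Rintegral_mirror l e1 iQ; rewrite IQ in IrQ.
  have iD (f g : 'rV[R]_n -> R) : L.-integrable setT (EFin \o f) ->
      L.-integrable setT (EFin \o g) ->
      L.-integrable setT (EFin \o (fun y => f y + g y)).
    by move=> hf hg; exact: (integrableD measurableT hf hg).
  have iB (f g : 'rV[R]_n -> R) : L.-integrable setT (EFin \o f) ->
      L.-integrable setT (EFin \o g) ->
      L.-integrable setT (EFin \o (fun y => f y - g y)).
    by move=> hf hg; exact: (integrableB measurableT hf hg).
  have iZ k (f : 'rV[R]_n -> R) : L.-integrable setT (EFin \o f) ->
      L.-integrable setT (EFin \o (fun y => k * f y)).
    by move=> hf; exact: (integrableZl measurableT k hf).
  have iA := iB _ _ ir1 i0; have iA' := iB _ _ i1 ir0.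
  have iC := iZ C _ iQ; have iC' := iZ C _ irQ; have iCC := iD _ _ iC iC'.
  have ic := iZ c _ iG.
  have le_int := le_Rintegral measurableT (iD _ _ iA iA') (iB _ _ iCC ic)
    (fun y _ => full eps y epsde).
  pose I1 := \int[L]_y F eps (refl x0) y; pose I0 := \int[L]_y F eps x0 y.
  have sub_eq (a b a' b' : R) : a = a' -> b = b' -> a - b = a' - b'.
    by move=> -> ->.
  have add_eq (a b a' b' : R) : a = a' -> b = b' -> a + b = a' + b'.
    by move=> -> ->.
  have mul_eq (k a a' : R) : a = a' -> k * a = k * a' by move=> ->.
  have eq_leq' (a b : R) : a = b -> a <= b by move=> ->.
  (* the integrals of both sides of full, by linearity and mirror invariance *)
  have EL := etrans (RintegralD measurableT iA iA')
    (add_eq _ _ _ _ (etrans (RintegralB measurableT ir1 i0)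
       (sub_eq _ _ I1 I0 (Rintegral_mirror l e1 i1) erefl))
      (etrans (RintegralB measurableT i1 ir0)
       (sub_eq _ _ I1 I0 erefl (Rintegral_mirror l e1 i0)))).
  have ER := etrans (RintegralB measurableT iCC ic)
    (sub_eq _ _ _ _ (etrans (RintegralD measurableT iC iC')
      (add_eq _ _ _ _ (etrans (RintegralZl C measurableT iQ) (mul_eq C _ _ IQ))
        (etrans (RintegralZl C measurableT irQ) (mul_eq C _ _ IrQ))))
      (etrans (RintegralZl c measurableT iG) (mul_eq c _ _ IG))).
  suff : I1 - I0 <= C * (2 * eps) ^+ n - c * m / 2 by exact.
  apply: le_halve.
  exact: le_trans (eq_leq' _ _ (esym EL)) (le_trans le_int (eq_leq' _ _ ER)).
have -> : - (c * m / 2) = C * (2 * 0) ^+ n - c * m / 2.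
  by rewrite mulr0 expr0n -[n == _]negbK -lt0n n0/= mulr0 sub0r.
apply: (@ler_cvg_to _ (0^'+) _ _ (fun eps => truncated_op mu a1 a2 u (refl x0) eps
  - truncated_op mu a1 a2 u x0 eps) (fun eps => C * (2 * eps) ^+ n - c * m / 2)).
- by apply: cvgB; [case: def1|case: def0].
- apply: cvgB; last exact: cvg_cst.
  apply: cvgMl_tmp.
  apply: (@cvg_comp R R R (fun t => 2 * t) (fun t => t ^+ n) (0^'+)
    (nbhs (2 * 0 : R)) (nbhs ((2 * 0 : R) ^+ n))).
    by apply: cvgMl_tmp; exact: cvg_at_right_filter cvg_id.
  exact: exprn_continuous.
- near=> eps; apply: trunc; apply/andP; split; near: eps.
    exact: nbhs_right_gt.
  exact: nbhs_right_lt.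
Unshelve. all: by end_near. Qed.

End operator_comparison.

(** * Locally Lipschitz functions on segments *)

Lemma locally_lipschitz_ball (R : realType) (f : R -> R) (t : R) :
  locally_lipschitz_on [set s | 0 <= s] f -> 0 <= t ->
  exists r k : R, [/\ 0 < r, 0 < k & forall x y, 0 <= x -> 0 <= y ->
    `|x - t| < r -> `|y - t| < r -> `|f x - f y| <= k * `|x - y|].
Proof.
move=> flip t0; have [U Ut [k0 [_ fU]]] := flip t t0.
move: Ut => /nbhs_ballP[r /= r0 rU].
exists r, (`|k0| + 1); split => //.
move=> x y x0 y0 xt yt.
apply: (fU (`|k0| + 1) _ (x, y)); first by rewrite (le_lt_trans (ler_norm _))// ltrDl.
by split; split => //=; apply: rU; rewrite /ball /= distrC.
Qed.

(** Compactness of the square: near a diagonal point (t, t) the local Lipschitz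
    constant serves, and near a point (s, t) with s != t the quotient is bounded
    because f is locally bounded and the denominator is at least |s - t| / 2. *)
Lemma lipschitz_segment (R : realType) (f : R -> R) (M : R) :
  locally_lipschitz_on [set s | 0 <= s] f ->
  exists2 C : R, 0 < C & forall s t, 0 <= s <= M -> 0 <= t <= M ->
    `|f s - f t| <= C * `|s - t|.
Proof.
move=> flip.
pose P (C : R) (z : R * R) := 0 <= z.1 -> 0 <= z.2 ->
  `|f z.1 - f z.2| <= C * `|z.1 - z.2|.
have cK : compact (`[0, M] `*` `[0, M] : set (R * R)).
  by apply: compact_setX; exact: segment_compact.
have := proj1 (compact_near_coveringP _) cK R (+oo%R) P _.
case=> [[s t] [/= sM tM]|C0 [_ CP]].
  have s0 : 0 <= s by move: sM; rewrite in_itv/= => /andP[].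
  have t0 : 0 <= t by move: tM; rewrite in_itv/= => /andP[].
  have [r1 [k1 [r1_gt0 k1_gt0 f1]]] := locally_lipschitz_ball flip s0.
  have [r2 [k2 [r2_gt0 k2_gt0 f2]]] := locally_lipschitz_ball flip t0.
  have [st|st] := eqVneq s t.
    exists ([set z : R * R | ball s r1 z.1 /\ ball t r1 z.2], [set C : R | k1 < C]).
      split => /=; last by apply: nbhs_pinfty_gt; exact: num_real.
      by exists (ball s r1, ball t r1) => //=; split; exact: nbhsx_ballx.
    move=> [[x y] C] /= [[]]; rewrite /ball /= -st => xs yt kC x0 y0.
    apply: le_trans (f1 _ _ x0 y0 _ _) _; rewrite 1?distrC//.
    by apply: ler_wpM2r => //; exact: ltW.
  pose d := `|s - t|.
  have d0 : 0 < d by rewrite normr_gt0 subr_eq0.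
  pose rho := Num.min (Num.min r1 r2) (d / 4).
  have rho0 : 0 < rho by rewrite !lt_min r1_gt0 r2_gt0/= divr_gt0.
  pose B := k1 * rho + `|f s - f t| + k2 * rho.
  exists ([set z : R * R | ball s rho z.1 /\ ball t rho z.2],
      [set C : R | 2 * B / d < C]).
    split => /=; last by apply: nbhs_pinfty_gt; exact: num_real.
    by exists (ball s rho, ball t rho) => //=; split; exact: nbhsx_ballx.
  move=> [[x y] C] /= [[]]; rewrite /ball /= => xs yt kC x0 y0.
  have [[rho_r1 rho_r2] rho_d] : (rho <= r1 /\ rho <= r2) /\ rho <= d / 4.
    by split; [split|]; rewrite !ge_min lexx ?orbT.
  rewrite distrC in xs.
  have fx : `|f x - f s| <= k1 * rho.
    apply: le_trans (f1 _ _ x0 s0 _ _) _; rewrite ?subrr ?normr0//.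
      exact: lt_le_trans rho_r1.
    by apply: ler_wpM2l; exact: ltW.
  have fy : `|f t - f y| <= k2 * rho.
    apply: le_trans (f2 _ _ t0 y0 _ _) _; rewrite ?subrr ?normr0//.
      by rewrite distrC; exact: lt_le_trans rho_r2.
    by apply: ler_wpM2l; exact: ltW.
  have fB : `|f x - f y| <= B.
    rewrite (_ : f x - f y = (f x - f s) + (f s - f t) + (f t - f y)); last by ring.
    apply: le_trans (ler_normD _ _) _; apply: lerD => //.
    by apply: le_trans (ler_normD _ _) _; apply: lerD.
  have xyd : d / 2 <= `|x - y|.
    have : d <= `|s - x| + `|x - y| + `|y - t|.
      rewrite /d (_ : s - t = (s - x) + (x - y) + (y - t)); last by ring.
      by apply: le_trans (ler_normD _ _) _; apply: lerD => //; exact: ler_normD.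
    rewrite (distrC s) (distrC y); lra.
  have B0 : 0 <= B by exact: le_trans fB.
  apply: (le_trans fB); apply: (@le_trans _ _ (2 * B / d * (d / 2))).
    by rewrite (_ : _ * _ = B)//; field; rewrite gt_eqF.
  by apply: ler_pM => //; rewrite ?divr_ge0 ?mulr_ge0// ltW.
exists (`|C0| + 1); first by rewrite ltr_wpDl.
move=> s t /andP[s0 sM] /andP[t0 tM].
apply: (CP _ _ (s, t)) => //=; first by rewrite (le_lt_trans (ler_norm _))// ltrDl.
by split; rewrite /= in_itv/= ?s0 ?t0.
Qed.

(** * Minima of w near the plane and zeros of w *)

Section comparison_lemmas.
Context {R : realType} {n : nat} (mu a1 a2 : R).
Hypotheses (mu01 : 0 <= mu <= 1) (a1_01 : 0 < a1 < 1) (a2_01 : 0 < a2 < 1).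
Hypothesis n0 : (0 < n)%N.
Local Notation K := (kernel_profile n mu a1 a2).

Lemma cube_lt_enormB (x y : 'rV[R]_n) r : 0 < r ->
  cube x (r / n.+1%:R) y -> enorm (y - x) < r.
Proof.
by move=> r0 xy; apply: cube_lt_enorm => // i; have := xy i; rewrite !mxE.
Qed.

Lemma powR_small (A p : R) : 0 < A -> 0 < p ->
  exists2 t0 : R, 0 < t0 & forall t, 0 < t < t0 -> t `^ p < A.
Proof.
move=> A0 p0; exists (A `^ (p^-1)); first exact: powR_gt0.
move=> t /andP[t_gt0 tA].
have pne : p != 0 by rewrite gt_eqF.
rewrite -[ltRHS](@powRr1 _ A) ?ltW// -(mulVf pne) powRrM.
by apply: gt0_ltr_powR => //; rewrite nnegrE ?powR_ge0// ltW.
Qed.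

(** With d the distance of x to the plane, op_mirror_le is applied with G a cube
    inside the ball of radius d around x.  There x - y' has length at most 3 d,
    so the integrand is at most 2 w(x) K(3 d), and |G| K(3 d) is a constant times
    d^(-2 a1), which exceeds C for small d. *)
Lemma negative_min_far (C : R) : 0 < C -> exists2 d0 : R, 0 < d0 &
  forall (u : 'rV[R]_n -> R) (e x : 'rV[R]_n) (l M : R),
    let w y := u (mirror e l y) - u y in
    dotv e e = 1 -> l < dotv x e ->
    op_defined mu a1 a2 u x -> op_defined mu a1 a2 u (mirror e l x) ->
    0 <= M -> (forall y, w y <= M) ->
    w x < 0 -> (forall y, l <= dotv y e -> w x <= w y) ->
    C * w x <= op mu a1 a2 u (mirror e l x) - op mu a1 a2 u x ->
    d0 <= dotv x e - l.
Proof.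
move=> C0.
(* q * (3 * d) is the side of the cube of half-side d / n.+1 *)
pose q : R := 2 / (3 * n.+1%:R).
have q0 : 0 < q by rewrite divr_gt0// mulr_gt0.
have p0 : 0 < 2 * a1 by rewrite mulr_gt0//; case/andP: a1_01.
have [t0 t0_gt0 t0P] := powR_small (divr_gt0 (exprn_gt0 n q0) C0) p0.
exists (Num.min 1 t0 / 3); first by rewrite divr_gt0// lt_min ltr01.
move=> u e x l M w e1 xl defx defmx M0 wM wx wmin opC.
rewrite leNgt; apply/negP => small.
pose de := dotv x e - l; have de0 : 0 < de by rewrite subr_gt0.
pose t := 3 * de.
have t_gt0 : 0 < t by rewrite mulr_gt0.
have [t1 tt0] : t < 1 /\ t < t0.
  apply/andP; rewrite -lt_min /t mulrC -ltr_pdivlMr//.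
have [K0 Kanti] : (forall r, 0 <= K r) /\
    (forall r s, 0 < r -> r <= s -> K s <= K r).
  by split => *; [exact: kernel_profile_ge0|exact: kernel_profile_anti].
have KtE : K t = (t ^+ n * t `^ (2 * a1))^-1.
  by apply: kernel_profile_near0 => //; rewrite t_gt0.
pose r := de / n.+1%:R.
have r0 : 0 <= r by rewrite divr_ge0// ltW.
pose G := cube x r.
have Gx y : G y -> `|dotv y e - dotv x e| < de /\ enorm (x - y) < de.
  move=> /(cube_lt_enormB de0) yx; split; last by rewrite enormBC.
  by rewrite -dotvBl; apply: le_lt_trans yx; exact: dotv_le_enorm.
have Gl y : G y -> l < dotv y e.
  by move=> /Gx[]; rewrite ltr_distl /de subKr => /andP[].
have wx2 : 2 * w x <= 0 by rewrite pmulr_rle0 ?ltr0n// ltW.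
have c0 : 0 <= - (2 * w x * K t).
  by rewrite oppr_ge0; exact: mulr_le0_ge0 wx2 (K0 t).
have := @op_mirror_le _ _ mu a1 a2 u mu01 a1_01 a2_01 e l e1 n0 x xl defx defmx
  G ((2 * r) ^+ n) (- (2 * w x * K t)) M wM M0 (ltW wx) wmin
  (measurable_cube x r) (lebesgue_cube x r0) _ c0 _.
move=> op_le.
have {op_le} : op mu a1 a2 u (mirror e l x) - op mu a1 a2 u x <=
    w x * (K t * (2 * r) ^+ n).
  apply: le_trans (op_le _ _) _.
  - exact: Gl.
  - move=> y Gy yx; have [yd ynx] := Gx _ Gy.
    have ab : enorm (x - y) <= enorm (x - mirror e l y).
      apply: le_enormB_mirror => //; first exact: ltW.
      exact: ltW (Gl _ Gy).
    have a0 : 0 < enorm (x - y) by apply: enormB_gt0; rewrite eq_sym.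
    have b0 := lt_le_trans a0 ab.
    have bt : enorm (x - mirror e l y) <= t.
      rewrite -(@ler_pXn2r _ 2) ?nnegrE ?(ltW b0) ?(ltW t_gt0)//.
      rewrite (sqr_enormB_mirror _ e1) -/de.
      have a2de : enorm (x - y) ^+ 2 <= de ^+ 2.
        by rewrite ler_pXn2r ?nnegrE ?(ltW a0) ?(ltW de0)// ltW.
      have yl2 : dotv y e - l <= 2 * de.
        rewrite lerBlDr; move: yd; rewrite ltr_distl => /andP[_ /ltW] /le_trans.
        by apply; rewrite (_ : 2 * de + l = dotv x e + de)// /de; ring.
      rewrite (_ : t ^+ 2 = de ^+ 2 + 4 * de * (2 * de)); last by rewrite /t; ring.
      by apply: lerD => //; rewrite ler_pM2l// mulr_gt0.
    have wy : w x - w y <= 0.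
      by rewrite subr_le0; exact: wmin _ (ltW (Gl _ Gy)).
    have Kab := Kanti _ _ a0 ab; have Ktb := Kanti _ _ b0 bt.
    rewrite opprK -[leRHS]add0r; apply: lerD.
      by apply: mulr_le0_ge0; [exact: wy|rewrite subr_ge0; exact: Kab].
    exact: (ler_wnM2l wx2 Ktb).
  rewrite le_eqVlt; apply/orP; left; apply/eqP; by field.
have -> : K t * (2 * r) ^+ n = q ^+ n / t `^ (2 * a1).
  rewrite KtE (_ : 2 * r = q * t); last first.
    by rewrite /r /q /t; field; rewrite nat1r.
  have T0 : t ^+ n != 0 by rewrite expf_neq0// gt_eqF.
  have P0 : t `^ (2 * a1) != 0 by rewrite gt_eqF// powR_gt0.
  rewrite [(q * t) ^+ n]exprMn; move: (t ^+ n) (t `^ _) (q ^+ n) T0 P0 => T P Q T0 P0.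
  by field; rewrite T0 P0.
move=> /(le_trans opC); rewrite mulrC ler_nM2l// leNgt => /negP; apply.
have := t0P t _; rewrite t_gt0 tt0 => /(_ isT) tA.
by rewrite ltr_pdivlMr ?powR_gt0// mulrC -ltr_pdivlMr.
Qed.

End comparison_lemmas.

Lemma nbhs_cube (R : realType) (n : nat) (x : 'rV[R]_n) (P : set 'rV[R]_n) :
  nbhs x P -> exists2 r : R, 0 < r & cube x r `<=` P.
Proof.
move=> /nbhs_ballP[r /= r0 rP]; exists (r / 2); first by rewrite divr_gt0.
move=> y xy; apply: rP; split => // i j.
rewrite (ord1 i) /ball /= distrC; apply: le_lt_trans (xy j) _.
by rewrite ltr_pdivrMr// ltr_pMr// ltr1n.
Qed.

Section strong_comparison.
Context {R : realType} {n : nat} (mu a1 a2 : R).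
Hypotheses (mu01 : 0 <= mu <= 1) (a1_01 : 0 < a1 < 1) (a2_01 : 0 < a2 < 1).
Hypothesis n0 : (0 < n)%N.
Local Notation K := (kernel_profile n mu a1 a2).

(** Strong maximum principle.  As w(x) = 0 the integrand of op_mirror_le is
    - w(y) (K(x - y) - K(x - y')), so one point y0 of the cap with w(y0) > 0 and
    |x - y0| < 1 is enough.  The point y0 = x / |x| qualifies: u vanishes at y0
    and not at its mirror image, which lies in the open ball.  The bound
    |x - y0| < 1 matters since K may vanish identically from distance 1 on. *)
Lemma zero_min_op_lt (u : 'rV[R]_n -> R) (e x : 'rV[R]_n) (l M : R) :
  let w y := u (mirror e l y) - u y in
  continuous u ->
  (forall y, enorm y < 1 -> 0 < u y) -> (forall y, 1 <= enorm y -> u y = 0) ->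
  dotv e e = 1 -> 0 < l -> l < dotv x e -> enorm x < 1 ->
  op_defined mu a1 a2 u x -> op_defined mu a1 a2 u (mirror e l x) ->
  0 <= M -> (forall y, w y <= M) ->
  w x = 0 -> (forall y, l <= dotv y e -> 0 <= w y) ->
  op mu a1 a2 u (mirror e l x) - op mu a1 a2 u x < 0.
Proof.
move=> w cu upos u0 e1 l0 xl x1 defx defmx M0 wM wx wmin.
have Nx0 : 0 < enorm x.
  apply: lt_le_trans (dotv_le_enorm x e1); apply: lt_le_trans (ler_norm _).
  exact: lt_trans xl.
pose y0 := (enorm x)^-1 *: x.
have Ny0 : enorm y0 = 1.
  by rewrite enormZ gtr0_norm ?invr_gt0// mulVf// gt_eqF.
have y0l : l < dotv y0 e.
  rewrite dotvZl mulrC ltr_pdivlMr//; apply: le_lt_trans xl.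
  by rewrite ger_pMr// ltW.
have xy0 : enorm (x - y0) = 1 - enorm x.
  have -> : x - y0 = (1 - (enorm x)^-1) *: x by rewrite scalerBl scale1r.
  rewrite enormZ ler0_norm; last by rewrite subr_le0 invf_ge1// ltW.
  by rewrite opprB mulrBl mulVf ?mul1r// gt_eqF.
pose a := enorm (x - y0); pose b := enorm (x - mirror e l y0).
have a0 : 0 < a by rewrite /a xy0 subr_gt0.
have a_lt1 : a < 1 by rewrite /a xy0 ltrBlDr ltrDl.
have ab : a < b.
  apply: ltr_enorm_sqr; rewrite sqr_enormB_mirror// ltrDl.
  by rewrite !mulr_gt0// subr_gt0.
have wy0 : 0 < w y0.
  rewrite /w (u0 y0) ?Ny0// subr0; apply: upos; rewrite -Ny0.
  apply: ltr_enorm_sqr; rewrite sqr_enorm_mirror// ltrBlDr ltrDl.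
  by rewrite !mulr_gt0// subr_gt0.
(* two radii separating |x - y| from |x - y'| uniformly for y near y0 *)
have [s1 [s2 [as1 s12 s2b s21]]] : exists s1 s2, [/\ a < s1, s1 < s2, s2 < b & s2 < 1].
  pose mn := Num.min b 1; have amn : a < mn by rewrite lt_min ab.
  have [mnb mn1] : mn <= b /\ mn <= 1 by split; rewrite !ge_min lexx ?orbT.
  exists ((2 * a + mn) / 3), ((a + 2 * mn) / 3).
  by clear -amn mnb mn1; split; lra.
have cm : mirror e l y @[y --> y0] --> mirror e l y0.
  exact: (@cvg_mirror R n e _ (nbhs y0) _ (fun=> l) id l y0 (cvg_cst _) cvg_id).
have cw : w y @[y --> y0] --> w y0.
  have cum : u (mirror e l y) @[y --> y0] --> u (mirror e l y0).
    exact: (@cvg_comp _ _ _ (mirror e l) u _ _ _ cm (cu _)).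
  exact: (cvgB cum (cu y0)).
have ca : enorm (x - y) @[y --> y0] --> a.
  have cxy : x - y @[y --> y0] --> x - y0.
    exact: (@cvgB _ _ _ (nbhs y0) _ (fun=> x) id x y0 (cvg_cst _) cvg_id).
  exact: (cvg_enorm cxy).
have cb : enorm (x - mirror e l y) @[y --> y0] --> b.
  have cxy : x - mirror e l y @[y --> y0] --> x - mirror e l y0.
    exact: (cvgB (f := fun=> x) (cvg_cst _) cm).
  exact: (cvg_enorm cxy).
have cd : dotv y e @[y --> y0] --> dotv y0 e.
  exact: (@cvg_dotv R n _ (nbhs y0) _ id (fun=> e) y0 e cvg_id (cvg_cst _)).
have wy02 : w y0 / 2 < w y0 by rewrite ltr_pdivrMr// ltr_pMr// ltr1n.
have near_y0 : nbhs y0 [set y | (w y0 / 2 < w y /\ enorm (x - y) < s1) /\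
    (s2 < enorm (x - mirror e l y) /\ l < dotv y e)].
  have n1 : \forall y \near y0, w y0 / 2 < w y by apply: (cvgr_gt _ cw).
  have n2 : \forall y \near y0, enorm (x - y) < s1 by apply: (cvgr_lt _ ca).
  have n3 : \forall y \near y0, s2 < enorm (x - mirror e l y).
    by apply: (cvgr_gt _ cb).
  have n4 : \forall y \near y0, l < dotv y e by apply: (cvgr_gt _ cd).
  exact: (filterI (filterI n1 n2) (filterI n3 n4)).
have [r r0 rP] := nbhs_cube near_y0.
have s1_0 := lt_trans a0 as1; have s2_0 := lt_trans s1_0 s12.
have K12 : 0 < K s1 - K s2 by rewrite subr_gt0; exact: kernel_profile_strict_anti.
pose c := w y0 / 2 * (K s1 - K s2).
have c0 : 0 < c by rewrite mulr_gt0// divr_gt0.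
have wx0 : w x <= 0 by rewrite wx.
have wmin' y : l <= dotv y e -> w x <= w y by rewrite wx; exact: wmin.
have Gl y : cube y0 r y -> l < dotv y e by move=> /rP[_ []].
apply: le_lt_trans (@op_mirror_le _ _ mu a1 a2 u mu01 a1_01 a2_01 e l e1 n0 x xl
  defx defmx (cube y0 r) ((2 * r) ^+ n) c M wM M0 wx0 wmin'
  (measurable_cube y0 r) (lebesgue_cube y0 (ltW r0)) Gl (ltW c0) _) _.
  move=> y /rP[[wy ay] [by_ _]] yx.
  rewrite -/(w x) -/(w y) wx mulr0 mul0r addr0 sub0r mulNr lerN2 /c.
  apply: ler_pM; [by rewrite divr_ge0// ltW|exact: ltW|exact: ltW|].
  apply: lerB; apply: kernel_profile_anti => //; try exact: ltW.
  by apply: enormB_gt0; rewrite eq_sym.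
by rewrite oppr_lt0 divr_gt0// mulr_gt0// exprn_gt0// mulr_gt0.
Qed.

End strong_comparison.

(** * Moving the plane *)

Lemma bisector (R : realType) (n : nat) (x y : 'rV[R]_n) : x != y ->
  exists e : 'rV[R]_n, let l := (enorm x ^+ 2 - enorm y ^+ 2) / (2 * enorm (x - y)) in
  [/\ dotv e e = 1, l < dotv x e & mirror e l x = y].
Proof.
move=> xy; have D0 := enormB_gt0 xy; set D := enorm (x - y) in D0 *.
have Dne : D != 0 by rewrite gt_eqF.
have DE : D ^+ 2 = dotv x x - 2 * dotv x y + dotv y y.
  by rewrite /D enorm_dotv !dotvE (dotvC y x); ring.
exists (D^-1 *: (x - y)) => /=; set l := _ / _.
have xel : dotv x (D^-1 *: (x - y)) - l = D / 2.
  rewrite /l !enorm_dotv !dotvE.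
  have -> : dotv y y = D ^+ 2 - dotv x x + 2 * dotv x y by rewrite DE; ring.
  by field.
split.
- by rewrite dotvZl dotvZr -enorm_dotv -/D; field.
- by rewrite -subr_gt0 xel divr_gt0.
- rewrite /mirror -opprB xel scalerA (_ : 2 * - (D / 2) * D^-1 = -1); last by field.
  by rewrite scaleN1r opprB addrC subrK.
Qed.

Lemma compact_ball_cap (R : realType) (n : nat) (e : 'rV[R]_n) (l : R) :
  compact [set x : 'rV[R]_n | enorm x <= 1 /\ l <= dotv x e].
Proof.
have cB : compact [set x : 'rV[R]_n | forall i, x ord0 i \in `[-1, 1]].
  apply: (@rV_compact R n (fun=> `[(-1), 1]%classic)) => _.
  exact: segment_compact.
apply: subclosed_compact cB _; last first.
  move=> x [x1 _] i /=; rewrite in_itv/= -ler_norml.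
  exact: le_trans (coord_le_enorm x i) x1.
apply: closedI.
  apply: (@preimage_closed _ _ (@enorm R n) [set t | t <= 1]); last exact: closed_le.
  by move=> x _; exact: (@cvg_enorm R n _ (nbhs x) _ id x cvg_id).
apply: (@preimage_closed _ _ (fun x => dotv x e) [set t | l <= t]); last exact: closed_ge.
by move=> x _; exact: (@cvg_dotv R n _ (nbhs x) _ id (fun=> e) x e cvg_id (cvg_cst _)).
Qed.

Section moving_planes.
Context {R : realType} {n : nat} (mu a1 a2 : R) (f : R -> R) (g u : 'rV[R]_n -> R).
Hypothesis n0 : (0 < n)%N.
Hypotheses (mu01 : 0 <= mu <= 1) (a1_01 : 0 < a1 < 1) (a2_01 : 0 < a2 < 1).
Hypothesis f_lip : locally_lipschitz_on [set t | 0 <= t] f.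
Hypothesis g_decr : radially_decreasing_on (@unit_ball R n) g.
Hypothesis u_pos : forall x, unit_ball x -> 0 < u x.
Hypothesis u_sol : classical_solution mu a1 a2 f g u.

Let cu : continuous u. Proof. by case: u_sol. Qed.

Let u_out y : 1 <= enorm y -> u y = 0.
Proof. by case: u_sol => _ _ uo y1; apply: uo => /lt_geF; rewrite y1. Qed.

Let u_in y : enorm y < 1 -> 0 < u y.
Proof. exact: u_pos. Qed.

Let u_ge0 y : 0 <= u y.
Proof. by have [/u_in/ltW//|/u_out ->] := ltP (enorm y) 1. Qed.

Let u_def x : enorm x < 1 -> op_defined mu a1 a2 u x.
Proof. by case: u_sol => _ ue _ /ue[]. Qed.

Lemma solution_bounded : exists2 M : R, 0 <= M & forall y, 0 <= u y <= M.
Proof.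
(* the closed ball, as the degenerate cap in direction 0 *)
pose A := [set x : 'rV[R]_n | enorm x <= 1 /\ 0 <= dotv x 0].
have d0 (x : 'rV[R]_n) : dotv x 0 = 0.
  by rewrite /dotv big1// => i _; rewrite mxE mulr0.
have A0 : A !=set0.
  exists 0; split; rewrite ?d0//.
  by rewrite -(scale0r (0 : 'rV[R]_n)) enormZ normr0 mul0r.
have [|c _ cmax] := EVT_max_rV A0 (@compact_ball_cap R n 0 0) (f := u).
  exact: continuous_subspaceT.
exists (u c) => // y; rewrite u_ge0/=.
have [y1|/u_out -> //] := ltP (enorm y) 1.
by apply: cmax; rewrite inE; split; rewrite ?d0// ltW.
Qed.

Section fixed_direction.
Variable e : 'rV[R]_n.
Hypothesis e1 : dotv e e = 1.
Let w l y := u (mirror e l y) - u y.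

Let mirror_in l x : 0 < l -> l < dotv x e -> enorm (mirror e l x) < enorm x.
Proof.
move=> l0 xl; apply: ltr_enorm_sqr; rewrite sqr_enorm_mirror// ltrBlDr ltrDl.
by rewrite !mulr_gt0// subr_gt0.
Qed.

Let w_out l y : 1 <= enorm y -> 0 <= w l y.
Proof. by move=> y1; rewrite /w (u_out y1) subr0. Qed.

(** For l > 0 the mirror image of a point of the cap is closer to the origin, so
    that the terms in g have the good sign. *)
Let op_diff_ge l x : 0 < l -> l < dotv x e -> enorm x < 1 ->
  f (u (mirror e l x)) - f (u x) <=
    op mu a1 a2 u (mirror e l x) - op mu a1 a2 u x.
Proof.
move=> l0 xl x1; have mx := mirror_in l0 xl; have mx1 := lt_trans mx x1.
case: u_sol => _ ue _; have [_ ->] := ue _ x1; have [_ ->] := ue _ mx1.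
by have := g_decr mx1 x1 mx; lra.
Qed.

Let cvg_w (l : R) (x : 'rV[R]_n) : (u (mirror e z.2 z.1) - u z.1) @[z --> (x, l)] --> w l x.
Proof.
have cm : mirror e z.2 z.1 @[z --> (x, l)] --> mirror e l x.
  by apply: (@cvg_mirror R n e _ (nbhs (x, l)) _ snd fst l x);
    [exact: cvg_snd|exact: cvg_fst].
have cum : u (mirror e z.2 z.1) @[z --> (x, l)] --> u (mirror e l x).
  exact: (@cvg_comp _ _ _ (fun z => mirror e z.2 z.1) u _ _ _ cm (@cu _)).
have cu1 : u z.1 @[z --> (x, l)] --> u x.
  apply: (@cvg_comp _ _ _ fst u _ (nbhs x) _ _ (@cu _));
    exact: cvg_fst.
exact: (cvgB cum cu1).
Qed.

Let cvg_w_plane (l : R) (x : 'rV[R]_n) : w l' x @[l' --> l] --> w l x.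
Proof.
have cm : mirror e l' x @[l' --> l] --> mirror e l x.
  exact: (@cvg_mirror R n e _ (nbhs l) _ id (fun=> x) l x cvg_id (cvg_cst _)).
have cum : u (mirror e l' x) @[l' --> l] --> u (mirror e l x).
  exact: (@cvg_comp _ _ _ (fun l' => mirror e l' x) u _ _ _ cm (@cu _)).
exact: (@cvgB _ _ _ (nbhs l) _ _ (fun=> u x) _ _ cum (cvg_cst _)).
Qed.

Let w_bounded : exists2 M : R, 0 <= M & forall l y, w l y <= M.
Proof.
have [M M0 uM] := solution_bounded; exists M => // l y.
have /andP[_ umM] := uM (mirror e l y); have /andP[u0 _] := uM y.
by rewrite /w lerBlDr (le_trans umM)// lerDl.
Qed.

(** On the sphere u vanishes at x but not at its mirror image; inside the ball a
    zero of w would contradict zero_min_op_lt. *)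
Lemma w_gt0 l : 0 < l -> (forall y, l <= dotv y e -> 0 <= w l y) ->
  forall x, l < dotv x e -> enorm x <= 1 -> 0 < w l x.
Proof.
move=> l0 wge0 x xl; rewrite le_eqVlt => /orP[/eqP x1|x1].
  rewrite /w (u_out (y := x)) ?x1// subr0; apply: u_in.
  by rewrite -x1; exact: mirror_in.
rewrite lt_neqAle wge0 ?(ltW xl)// andbT eq_sym; apply/eqP => wx.
have [M M0 wM] := w_bounded.
have := zero_min_op_lt mu01 a1_01 a2_01 n0 cu u_in u_out e1 l0 xl x1
  (u_def x1) (u_def (lt_trans (mirror_in l0 xl) x1)) M0 (wM l) wx wge0.
apply/negP; rewrite -leNgt; apply: le_trans (op_diff_ge l0 xl x1).
by move/eqP: wx; rewrite /w subr_eq0 => /eqP ->; rewrite subrr.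
Qed.

(** Outside the ball w >= 0, so that a negative value of w on the cap yields a
    negative minimum over the whole cap, attained inside the ball. *)
Let negative_min : exists2 d0 : R, 0 < d0 & forall l, 0 < l ->
  (exists2 y, l <= dotv y e & w l y < 0) ->
  exists x, [/\ l + d0 <= dotv x e, enorm x < 1 & w l x < 0].
Proof.
have [M M0 uM] := solution_bounded.
have [C C0 fC] := lipschitz_segment M f_lip.
have [d0 d0_gt0 far] := negative_min_far mu01 a1_01 a2_01 n0 C0.
exists d0 => // l l0 [y yl wy].
pose A := [set x : 'rV[R]_n | enorm x <= 1 /\ l <= dotv x e].
have wneg1 z : w l z < 0 -> enorm z < 1.
  by move=> wz; rewrite ltNge; apply: contraTN wz => /(w_out l); rewrite leNgt.
have A0 : A !=set0 by exists y; split => //; exact: ltW (wneg1 _ wy).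
have cw : continuous (w l).
  move=> x.
  have cm : mirror e l z @[z --> x] --> mirror e l x.
    exact: (@cvg_mirror R n e _ (nbhs x) _ (fun=> l) id l x (cvg_cst _) cvg_id).
  have cum : u (mirror e l z) @[z --> x] --> u (mirror e l x).
    exact: (@cvg_comp _ _ _ (mirror e l) u _ _ _ cm (@cu _)).
  exact: (cvgB cum (@cu x)).
have [|x xA xmin] := EVT_min_rV A0 (@compact_ball_cap R n e l) (f := w l).
  exact: continuous_subspaceT.
have [x1 xl] : A x by rewrite inE in xA.
have wx : w l x < 0.
  apply: (le_lt_trans (xmin y _) wy).
  by rewrite inE; split => //; exact: ltW (wneg1 _ wy).
have wmin z : l <= dotv z e -> w l x <= w l z.
  move=> zl; have [z1|z1] := leP (enorm z) 1; first by apply: xmin; rewrite inE.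
  by apply: (le_trans (ltW wx)); exact: w_out (ltW z1).
have {}x1 := wneg1 _ wx.
have {}xl : l < dotv x e.
  rewrite lt_neqAle xl andbT; apply: contraTN wx => /eqP xl'.
  by rewrite /w mirror_fix// subrr ltxx.
have [Mw Mw0 wM] := w_bounded.
exists x; split => //; rewrite -lerBrDl.
apply: (far u e x l Mw e1 xl (u_def x1) (u_def (lt_trans (mirror_in l0 xl) x1))
  Mw0 (wM l) wx wmin).
apply: le_trans (op_diff_ge l0 xl x1).
have := fC _ _ (uM (mirror e l x)) (uM x).
by rewrite -/(w l x) (ltr0_norm wx) mulrN ler_norml opprK => /andP[].
Qed.

(** The supremum l0 may be 1: the compact set on which w_l0 > 0 is then empty,
    and the contradiction with the distance d0 is the usual starting step, that
    caps thinner than d0 contain no negative minimum. *)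
Lemma w_ge0 l y : 0 < l -> l <= dotv y e -> 0 <= w l y.
Proof.
move=> l0_gt0 yl; rewrite leNgt; apply/negP => wy.
pose Bad := [set l | 0 < l /\ exists2 y, l <= dotv y e & w l y < 0].
have Bad0 : Bad !=set0 by exists l; split => //; exists y.
have Bad1 : ubound Bad 1.
  move=> k [_ [z kz wz]]; apply: (le_trans kz); apply: le_trans (ler_norm _) _.
  apply: le_trans (dotv_le_enorm z e1) _; rewrite leNgt.
  by apply: contraTN wz => /ltW/(w_out k); rewrite leNgt.
have hsup : has_sup Bad by split => //; exists 1.
pose l0 := sup Bad.
have l0_pos : 0 < l0.
  by apply: (lt_le_trans l0_gt0); apply: ub_le_sup; [exists 1|split => //; exists y].
have wl0 z : l0 <= dotv z e -> 0 <= w l0 z.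
  rewrite le_eqVlt => /orP[/eqP zl0|zl0].
    by rewrite /w mirror_fix// subrr.
  rewrite leNgt; apply/negP => wz.
  have near_neg : \forall k \near l0, w k z < 0.
    by apply: (cvgr_lt _ (@cvg_w_plane l0 z)).
  have near_lt : \forall k \near l0, k < dotv z e.
    by apply: (cvgr_lt _ (@cvg_id _ (nbhs l0))).
  (* a negative value at l0 persists for some k > l0 *)
  have [k [[wk kz] kl0]] : exists k, (w k z < 0 /\ k < dotv z e) /\ l0 < k.
    near l0^'+ => k; exists k; split; [split|]; near: k.
    - exact: (cvg_within _ near_neg).
    - exact: (cvg_within _ near_lt).
    - exact: nbhs_right_gt.
  suff : k <= l0 by rewrite leNgt kl0.
  apply: ub_le_sup; first by exists 1.
  by split; [exact: lt_trans kl0|exists z => //; exact: ltW].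
have [d0 d0_gt0 far] := negative_min.
have w_pos : \forall k \near l0,
    [set x : 'rV[R]_n | enorm x <= 1 /\ l0 + d0 / 2 <= dotv x e] `<=`
    [set x | 0 < w k x].
  apply: (proj1 (compact_near_coveringP _) (@compact_ball_cap R n e (l0 + d0 / 2))
    R (nbhs l0) (fun k x => 0 < w k x) _) => x [x1 xl].
  have wx : 0 < w l0 x.
    by apply: w_gt0 => //; apply: lt_le_trans xl; rewrite ltrDl divr_gt0.
  have near_w : \forall z \near (x, l0), 0 < u (mirror e z.2 z.1) - u z.1.
    by apply: (cvgr_gt _ (@cvg_w l0 x)).
  exact: near_w.
have near_l0 : \forall k \near l0, l0 - d0 / 2 < k.
  by apply: (cvgr_gt _ (@cvg_id _ (nbhs l0))); rewrite gtrBl divr_gt0.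
have [r /= r0 rP] := (proj1 (nbhs_ballP _ _)) (filterI w_pos near_l0).
have [k [k0 Badk] kl0] := sup_adherent r0 hsup.
have kl0' : k <= l0 by apply: ub_le_sup; [exists 1|split].
have [kpos kd] : [set x | enorm x <= 1 /\ l0 + d0 / 2 <= dotv x e] `<=`
    [set x | 0 < w k x] /\ l0 - d0 / 2 < k.
  apply: rP; rewrite /ball /= ger0_norm ?subr_ge0//.
  by rewrite ltrBlDr -ltrBlDl.
have [x [xk x1 wx]] := far k k0 Badk.
have /= : 0 < w k x by apply: kpos; split; [exact: ltW|lra].
by rewrite ltNge (ltW wx).
Unshelve. all: by end_near. Qed.

End fixed_direction.

Lemma solution_mirror_gt (e x : 'rV[R]_n) (l : R) : dotv e e = 1 ->
  0 < l -> l < dotv x e -> enorm x <= 1 -> u x < u (mirror e l x).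
Proof.
move=> e1 l0 xl x1; rewrite -subr_gt0.
by apply: (w_gt0 e1 l0) => // y yl; exact: w_ge0.
Qed.

(** The plane through the origin, as the limit l -> 0+. *)
Lemma solution_mirror_ge (e x : 'rV[R]_n) : dotv e e = 1 ->
  0 < dotv x e -> u x <= u (mirror e 0 x).
Proof.
move=> e1 xe.
have cm : mirror e l' x @[l' --> (0 : R)] --> mirror e 0 x.
  exact: (@cvg_mirror R n e _ (nbhs (0 : R)) _ id (fun=> x) 0 x cvg_id (cvg_cst _)).
have cum : u (mirror e l' x) @[l' --> (0 : R)] --> u (mirror e 0 x).
  exact: (@cvg_comp _ _ _ (fun l' => mirror e l' x) u _ _ _ cm (@cu _)).
apply: (@ler_cvg_to _ (0^'+) _ _ (fun=> u x) (fun l => u (mirror e l x))).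
- exact: cvg_cst.
- exact: cvg_at_right_filter cum.
- near=> l; rewrite -subr_ge0; apply: w_ge0 => //.
  by apply: ltW; near: l; exact: nbhs_right_lt.
Unshelve. all: by end_near. Qed.

Lemma solution_radial : radially_symmetric_on [set: 'rV[R]_n] u.
Proof.
have le x y : enorm x = enorm y -> u x <= u y.
  move=> xy; have [->//|/bisector[e]] := eqVneq x y.
  rewrite xy subrr mul0r => -[e1 xe <-]; exact: solution_mirror_ge.
by move=> x y _ _ xy; apply/eqP; rewrite eq_le !le.
Qed.

Lemma solution_strictly_decreasing x y : enorm x < enorm y -> enorm y <= 1 ->
  u y < u x.
Proof.
move=> xy y1; have yx : y != x by apply: contraTneq xy => ->; rewrite ltxx.
have [e /= [e1 ye <-]] := bisector yx.
apply: solution_mirror_gt => //; apply: divr_gt0; last first.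
  by rewrite mulr_gt0// enormB_gt0.
by rewrite subr_gt0 ltr_pXn2r ?nnegrE ?enorm_ge0.
Qed.

End moving_planes.

Unset Implicit Arguments.

Theorem theorem6p1 (R : realType) (N : nat) (mu alpha1 alpha2 : R)
    (f : R -> R) (g u : 'rV[R]_N -> R)
    (hN : (2 <= N)%N)
    (hmu : 0 <= mu <= 1)
    (halpha1 : 0 < alpha1 < 1)
    (halpha2 : 0 < alpha2 < 1)
    (hf : locally_lipschitz_on [set t | 0 <= t] f)
    (hg_radial : radially_symmetric_on (@unit_ball R N) g)
    (hg_decr : radially_decreasing_on (@unit_ball R N) g)
    (hu_pos : forall x, unit_ball x -> 0 < u x)
    (hu : classical_solution mu alpha1 alpha2 f g u) :
  radially_symmetric_on [set: 'rV[R]_N] u /\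
  radially_strictly_decreasing_on [set x | 0 < enorm x < 1] u.
Proof.
have N0 : (0 < N)%N := ltnW hN.
split; first exact: (solution_radial N0 hmu halpha1 halpha2 hf hg_decr hu_pos hu).
move=> x y _ /andP[_ y1] xy.
exact: (solution_strictly_decreasing N0 hmu halpha1 halpha2 hf hg_decr hu_pos hu
  xy (ltW y1)).
Qed.
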